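(* Let $G$ be a finitely generated, non-elementary, Gromov hyperbolic group and let $\phi$ be any automorphism of $G$. Then the Reidemeister number $R(\phi)$ is infinite.
   Context: For an endomorphism $\phi:G\to G$, two elements $\alpha,\alpha'\in G$ are called $\phi$-conjugate if there exists $\gamma\in G$ with $\alpha'=\gamma\alpha\phi(\gamma)^{-1}$; the Reidemeister number $R(\phi)\in\mathbb{N}\cup\{\infty\}$ is the number of $\phi$-conjugacy classes. A group is non-elementary if it is not virtually cyclic. *)

(* Defs.v *)
From Stdlib Require Import ZArith List Lia.
Import ListNotations.

Record Group := {
  carrier :> Type;
  gmul : carrier -> carrier -> carrier;
  gone : carrier;
  ginv : carrier -> carrier;
  gmul_assoc : forall x y z, gmul x (gmul y z) = gmul (gmul x y) z;
  gmul_1l : forall x, gmul gone x = x;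
  gmul_Vl : forall x, gmul (ginv x) x = gone
}.

Arguments gmul {g} _ _.
Arguments gone {g}.
Arguments ginv {g} _.

Section Defs.
Variable G : Group.

Definition letter_val (l : bool * G) : G :=
  if fst l then ginv (snd l) else snd l.

Definition eval_word (w : list (bool * G)) : G :=
  fold_right (fun l acc => gmul (letter_val l) acc) gone w.

Definition word_over (S : list G) (w : list (bool * G)) : Prop :=
  forall l, In l w -> In (snd l) S.

Definition generates (S : list G) : Prop :=
  forall g : G, exists w, word_over S w /\ eval_word w = g.

Definition finitely_generated : Prop := exists S : list G, generates S.

Definition word_dist (S : list G) (x y : G) (n : nat) : Prop :=
  (exists w, word_over S w /\ length w = n /\ gmul x (eval_word w) = y) /\
  (forall w, word_over S w -> gmul x (eval_word w) = y -> n <= length w).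

(* Gromov's four-point definition of delta-hyperbolicity of the metric
   space (G, d_S), written with twice the Gromov product
   2 (x|y)_w = d(x,w) + d(y,w) - d(x,y), so that everything is integral:
   (x|y)_w >= min((x|z)_w, (y|z)_w) - delta. *)
Definition hyperbolic_wrt (S : list G) (delta : nat) : Prop :=
  forall x y z w : G, forall dxw dyw dzw dxy dxz dyz : nat,
    word_dist S x w dxw -> word_dist S y w dyw -> word_dist S z w dzw ->
    word_dist S x y dxy -> word_dist S x z dxz -> word_dist S y z dyz ->
    (Z.of_nat dxw + Z.of_nat dyw - Z.of_nat dxy >=
     Z.min (Z.of_nat dxw + Z.of_nat dzw - Z.of_nat dxz)
           (Z.of_nat dyw + Z.of_nat dzw - Z.of_nat dyz)
     - 2 * Z.of_nat delta)%Z.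

Definition gromov_hyperbolic_group : Prop :=
  exists (S : list G) (delta : nat), generates S /\ hyperbolic_wrt S delta.

Fixpoint npow (a : G) (n : nat) : G :=
  match n with O => gone | S k => gmul a (npow a k) end.

Definition zpow (a : G) (z : Z) : G :=
  match z with
  | Z0 => gone
  | Zpos p => npow a (Pos.to_nat p)
  | Zneg p => ginv (npow a (Pos.to_nat p))
  end.

Definition virtually_cyclic : Prop :=
  exists (a : G) (T : list G),
    forall g : G, exists t z, In t T /\ g = gmul t (zpow a z).

Definition non_elementary : Prop := ~ virtually_cyclic.

Definition is_endomorphism (phi : G -> G) : Prop :=
  forall x y, phi (gmul x y) = gmul (phi x) (phi y).

Definition is_automorphism (phi : G -> G) : Prop :=
  is_endomorphism phi /\
  (forall x y, phi x = phi y -> x = y) /\ (forall y, exists x, phi x = y).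

Definition phi_conj (phi : G -> G) (alpha alpha' : G) : Prop :=
  exists gamma : G, alpha' = gmul gamma (gmul alpha (ginv (phi gamma))).

Definition reidemeister_finite (phi : G -> G) : Prop :=
  exists reps : list G, forall g : G, exists r, In r reps /\ phi_conj phi r g.

Definition reidemeister_infinite (phi : G -> G) : Prop :=
  ~ reidemeister_finite phi.

End Defs.

(* Main.v *)
(** The twisted class of [a] contains one of finitely many short elements [r] exactly when some
    [x] satisfies [x r = a phi(x)], that is, when the map [f(y) = a phi(y)] moves [x] a bounded
    distance. For an automorphism [psi] put the metric |psi(x^-1 y)| on [G], and normalise [psi]
    by inner automorphisms so that 1 minimises the displacement [mu] of a fixed finite set [F].
    When [psi] commutes with [phi] up to inner automorphisms, [f] is an isometry from the
    [psi phi]-metric to the [psi]-metric and the two metrics are uniformly quasi-isometric.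
    Suppose that, uniformly in [psi], the segment from 1 to [a] is long in units of [mu] and
    diverges quickly from the segment from 1 to [f^-1(1) = phi^-1(a)^-1]. Then an almost fixed
    point [x] of [f] that shares a long initial part with [1,a] keeps doing so for [psi phi],
    [psi phi^2], ..., while its distance to the base point strictly decreases, which is absurd;
    the same applies to [f^-1], and one of the two alternatives must hold.

    For [a] one takes [h^m t], where [h] has translation length at least a fixed multiple of [mu]
    for every normalised [psi]. Such an [h] exists: for each [psi] some product of at most two
    elements of [F] translates by at least [mu/8], since otherwise the base point could be
    improved; these finitely many elements are merged, two at a time, into u^M v^M.
    The bounds are uniform in [psi] because of one algebraic fact: if two elements move both ends
    of a very long segment a bounded amount, their commutator commutes with a power of one of them. *)
Require Import Defs.
From Stdlib Require Import ZArith List Lia Classical ClassicalEpsilon.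
Import ListNotations.

Local Open Scope Z_scope.

Notation "x ** y" := (gmul x y) (at level 40, left associativity).
Notation "! x" := (ginv x) (at level 35, right associativity).
Notation "x ^^ n" := (npow _ x n) (at level 30, right associativity).

(** * Cancellation and inverses in a group given by its left axioms *)

Section GroupAlgebra.
Context {G : Group}.
Implicit Types x y z a b t : G.

Lemma gmul_cancel_l x y z : x ** y = x ** z -> y = z.
Proof.
  intro E. rewrite <- (gmul_1l G y), <- (gmul_1l G z), <- (gmul_Vl G x).
  now rewrite <- !gmul_assoc, E.
Qed.

Lemma gmul_Vr x : x ** !x = gone.
Proof.
  apply (gmul_cancel_l (!x)).
  rewrite gmul_assoc, gmul_Vl, gmul_1l.
  apply (gmul_cancel_l (!!x)).
  now rewrite gmul_assoc, gmul_Vl, gmul_1l.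
Qed.

Lemma gmul_1r x : x ** gone = x.
Proof. now rewrite <- (gmul_Vl G x), gmul_assoc, gmul_Vr, gmul_1l. Qed.

Lemma gmul_Vl_assoc x y : !x ** (x ** y) = y.
Proof. now rewrite gmul_assoc, gmul_Vl, gmul_1l. Qed.

Lemma gmul_Vr_assoc x y : x ** (!x ** y) = y.
Proof. now rewrite gmul_assoc, gmul_Vr, gmul_1l. Qed.

Lemma ginv_unique x y : x ** y = gone -> y = !x.
Proof. intro E. apply (gmul_cancel_l x). now rewrite E, gmul_Vr. Qed.

Lemma ginv_inv x : !!x = x.
Proof. symmetry. apply ginv_unique, gmul_Vl. Qed.

Lemma ginv_one : !gone = gone :> G.
Proof. symmetry. apply ginv_unique, gmul_1l. Qed.

Lemma ginv_mul x y : !(x ** y) = !y ** !x.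
Proof.
  symmetry. apply ginv_unique.
  now rewrite <- gmul_assoc, (gmul_assoc G y), gmul_Vr, gmul_1l, gmul_Vr.
Qed.

Lemma gmul_assoc_r x y z : x ** y ** z = x ** (y ** z).
Proof. now rewrite gmul_assoc. Qed.

End GroupAlgebra.

#[local] Hint Rewrite @gmul_assoc_r @gmul_1l @gmul_1r @gmul_Vl @gmul_Vr
  @gmul_Vl_assoc @gmul_Vr_assoc @ginv_inv @ginv_one @ginv_mul : grp.

Ltac grp := autorewrite with grp.
Ltac grp_eq := autorewrite with grp; reflexivity.

(** * Natural powers, commutation and elements of infinite order *)

Section Powers.
Context {G : Group}.
Implicit Types x y z a b t : G.

Lemma gmul_cancel_r x y z : x ** z = y ** z -> x = y.
Proof.
  intro E. rewrite <- (gmul_1r x), <- (gmul_1r y), <- (gmul_Vr z).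
  now rewrite !gmul_assoc, E.
Qed.

Lemma conj_inj t x y : t ** x ** !t = t ** y ** !t -> x = y.
Proof. intro E. now apply gmul_cancel_r, gmul_cancel_l in E. Qed.

Lemma npow_S a n : a ^^ (S n) = a ** a ^^ n.
Proof. reflexivity. Qed.

Lemma npow_1 a : a ^^ 1 = a.
Proof. cbn. grp_eq. Qed.

Lemma npow_add a n m : a ^^ (n + m) = a ^^ n ** a ^^ m.
Proof. induction n as [|n IH]; cbn; grp; [|rewrite IH]; grp_eq. Qed.

Lemma npow_Sr a n : a ^^ (S n) = a ^^ n ** a.
Proof. rewrite <- Nat.add_1_r, npow_add, npow_1. reflexivity. Qed.

Lemma npow_one n : gone ^^ n = gone :> G.
Proof. induction n as [|n IH]; cbn; [|rewrite IH]; grp; reflexivity. Qed.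

Lemma npow_mul a n m : a ^^ (n * m) = (a ^^ n) ^^ m.
Proof.
  induction m as [|m IH]; [now rewrite Nat.mul_0_r|].
  now rewrite Nat.mul_succ_r, Nat.add_comm, npow_add, IH.
Qed.

Lemma npow_conj t a n : (t ** a ** !t) ^^ n = t ** a ^^ n ** !t.
Proof. induction n as [|n IH]; cbn; [|rewrite IH]; grp_eq. Qed.

Lemma npow_comm x a n : x ** a = a ** x -> x ** a ^^ n = a ^^ n ** x.
Proof.
  intro E. induction n as [|n IH]; cbn; grp; [reflexivity|].
  rewrite <- IH, gmul_assoc, E. grp_eq.
Qed.

Lemma npow_comm_self a n : a ** a ^^ n = a ^^ n ** a.
Proof. now apply npow_comm. Qed.

Lemma npow_inv a n : (!a) ^^ n = !(a ^^ n).
Proof.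
  induction n as [|n IH]; [cbn; grp_eq|].
  rewrite npow_Sr, IH, npow_S. grp_eq.
Qed.

Lemma npow_sub a n m : (m <= n)%nat -> a ^^ (n - m) = a ^^ n ** !(a ^^ m).
Proof.
  intro H. replace n with (n - m + m)%nat at 2 by lia. rewrite npow_add. grp_eq.
Qed.

Lemma comm_inv_r x a : x ** a = a ** x -> x ** !a = !a ** x.
Proof.
  intro E. apply (gmul_cancel_l a). rewrite gmul_assoc, <- E. grp_eq.
Qed.

Lemma comm_mul x a b : x ** a = a ** x -> x ** b = b ** x -> x ** (a ** b) = a ** b ** x.
Proof. intros Ea Eb. rewrite gmul_assoc, Ea. grp. now rewrite Eb. Qed.

Definition infinite_order a : Prop := forall n, (n > 0)%nat -> a ^^ n <> gone.

Lemma infinite_order_inj a n m : infinite_order a -> a ^^ n = a ^^ m -> n = m.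
Proof.
  intros Ha. revert n m.
  assert (K : forall n m, (n < m)%nat -> a ^^ n <> a ^^ m).
  { intros n m Hnm E. apply (Ha (m - n)%nat); [lia|].
    rewrite npow_sub by lia. rewrite <- E. grp_eq. }
  intros n m E. destruct (Nat.lt_trichotomy n m) as [H|[H|H]]; trivial.
  - now destruct (K _ _ H).
  - symmetry in E. now destruct (K _ _ H).
Qed.

Lemma infinite_order_conj t a : infinite_order a -> infinite_order (t ** a ** !t).
Proof.
  intros Ha n Hn E. apply (Ha n Hn). rewrite npow_conj in E.
  apply (conj_inj t). rewrite E. grp_eq.
Qed.

Lemma infinite_order_pow a n : (n > 0)%nat -> infinite_order a -> infinite_order (a ^^ n).
Proof. intros Hn Ha m Hm. rewrite <- npow_mul. apply Ha. nia. Qed.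

End Powers.

(** * Endomorphisms and their conjugates *)

Section Homs.
Context {G : Group}.
Implicit Types x y z a b t : G.

Definition hom_inj (psi : G -> G) : Prop :=
  is_endomorphism G psi /\ forall x y, psi x = psi y -> x = y.

Lemma hom_one psi : is_endomorphism G psi -> psi gone = gone.
Proof.
  intro H. apply (gmul_cancel_l (psi gone)). now rewrite <- H, gmul_1r, gmul_1r.
Qed.

Lemma hom_inv psi x : is_endomorphism G psi -> psi (!x) = !(psi x).
Proof.
  intro H. apply ginv_unique. now rewrite <- H, gmul_Vr, hom_one.
Qed.

Lemma hom_pow psi x n : is_endomorphism G psi -> psi (x ^^ n) = psi x ^^ n.
Proof.
  intro H. induction n as [|n IH]; cbn; [now apply hom_one|]. now rewrite H, IH.
Qed.

Definition conj_by t (psi : G -> G) : G -> G := fun x => t ** psi x ** !t.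

Lemma conj_hom t psi : is_endomorphism G psi -> is_endomorphism G (conj_by t psi).
Proof. intros H x y. unfold conj_by. rewrite H. grp_eq. Qed.

Lemma conj_hom_inj t psi : hom_inj psi -> hom_inj (conj_by t psi).
Proof.
  intros [H I]. split; [now apply conj_hom|].
  intros x y E. now apply I, (conj_inj t).
Qed.

Lemma comp_hom_inj psi chi : hom_inj psi -> hom_inj chi -> hom_inj (fun x => psi (chi x)).
Proof.
  intros [H I] [H' I']. split; [intros x y; now rewrite H', H|].
  intros x y E. now apply I', I.
Qed.

End Homs.

(** * Integer division, extremal naturals and the pigeonhole principle *)

Lemma floor_div x k : 0 < k -> exists r, k * r <= x < k * r + k.
Proof.
  intro Hk. exists (x / k). pose proof (Z.mul_div_le x k Hk).
  pose proof (Z.mul_succ_div_gt x k Hk). lia.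
Qed.

Lemma nat_least (P : nat -> Prop) : (exists n, P n) ->
  exists n, P n /\ forall m, P m -> (n <= m)%nat.
Proof.
  intros [n Hn]. revert Hn. induction n as [n IH] using lt_wf_ind. intro Hn.
  destruct (classic (exists m, (m < n)%nat /\ P m)) as [[m [Hm Pm]]|H]; [eauto|].
  exists n. split; trivial. intros m Pm.
  destruct (Nat.lt_ge_cases m n); trivial. destruct H; eauto.
Qed.

Lemma nat_greatest (P : nat -> Prop) (b : nat) :
  (exists n, P n) -> (forall n, P n -> (n <= b)%nat) ->
  exists n, P n /\ forall m, P m -> (m <= n)%nat.
Proof.
  intros [n Hn] Hb.
  destruct (nat_least (fun k => exists m, P m /\ (k = b - m)%nat)) as [k [[m [Pm ->]] Hk]]; eauto.
  exists m. split; trivial. intros m' Pm'.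
  specialize (Hk (b - m')%nat (ex_intro _ m' (conj Pm' eq_refl))).
  pose proof (Hb _ Pm). pose proof (Hb _ Pm'). lia.
Qed.

Lemma pigeonhole {T : Type} (f : nat -> T) (l : list T) :
  (forall i, (i <= length l)%nat -> In (f i) l) ->
  exists i j, (i < j <= length l)%nat /\ f i = f j.
Proof.
  intro H. apply NNPP. intro N.
  assert (D : NoDup (map f (seq 0 (S (length l))))).
  { apply NoDup_nth with (d := f 0%nat). rewrite length_map, length_seq.
    intros i j Hi Hj. rewrite !map_nth, !seq_nth by lia. cbn. intro E.
    destruct (Nat.lt_trichotomy i j) as [K|[K|K]]; trivial; destruct N.
    - exists i, j. split; [lia|trivial].
    - exists j, i. split; [lia|auto]. }
  apply NoDup_incl_length with (l' := l) in D.
  - rewrite length_map, length_seq in D. lia.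
  - intros y Hy. apply in_map_iff in Hy. destruct Hy as [i [<- Hi]].
    apply in_seq in Hi. apply H. lia.
Qed.

(** * Four-point hyperbolic geometry of a length function *)

Definition dist {G : Group} (len : G -> Z) (x y : G) : Z := len (!x ** y).

(* Twice the Gromov product of [x] and [y] seen from [w]. *)
Definition gprod {G : Group} (len : G -> Z) (w x y : G) : Z :=
  dist len w x + dist len w y - dist len x y.

(** The geometry uses word length only through these properties: finite balls, geodesics at integer
    times, and the four-point condition in symmetric form. [D] is the constant for doubled Gromov
    products. *)
Record hyp_length (G : Group) (len : G -> Z) (D : Z) : Prop := {
  len_nonneg : forall g, 0 <= len g;
  len_one : len gone = 0;
  len_inv : forall g, len (!g) = len g;
  len_mul : forall g h, len (g ** h) <= len g + len h;
  len_ball : forall r, exists l : list G, forall g, len g <= r -> In g l;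
  len_path : forall g, exists c : nat -> G,
    c 0%nat = gone /\ c (Z.to_nat (len g)) = g /\
    forall i j, (i <= j <= Z.to_nat (len g))%nat -> dist len (c i) (c j) = Z.of_nat (j - i);
  D_pos : 1 <= D;
  four_point : forall x y z w,
    dist len x y + dist len z w <=
    Z.max (dist len x z + dist len y w) (dist len x w + dist len y z) + D
}.

Arguments len_nonneg {G len D}. Arguments len_one {G len D}.
Arguments len_inv {G len D}. Arguments len_mul {G len D}.
Arguments len_ball {G len D}. Arguments len_path {G len D}.
Arguments D_pos {G len D}. Arguments four_point {G len D}.

Section Geometry.
Context {G : Group} {len : G -> Z} {D : Z} (L : hyp_length G len D).
Implicit Types x y z w p q g s t u v : G.
Local Notation d := (dist len).
Local Notation gp := (gprod len).

Lemma dist_one x : d gone x = len x.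
Proof. unfold dist. grp. reflexivity. Qed.

Lemma dist_refl x : d x x = 0.
Proof. unfold dist. grp. apply (len_one L). Qed.

Lemma dist_sym x y : d x y = d y x.
Proof. unfold dist. rewrite <- (len_inv L). f_equal. grp_eq. Qed.

Lemma dist_nonneg x y : 0 <= d x y.
Proof. apply (len_nonneg L). Qed.

Lemma dist_tri x y z : d x z <= d x y + d y z.
Proof.
  unfold dist. replace (!x ** z) with ((!x ** y) ** (!y ** z)) by grp_eq.
  apply (len_mul L).
Qed.

Lemma dist_mul g x y : d (g ** x) (g ** y) = d x y.
Proof. unfold dist. f_equal. grp_eq. Qed.

Lemma dist_mul_r x y : d x (x ** y) = len y.
Proof. unfold dist. grp. reflexivity. Qed.

Lemma dist_mul_l g x y : d (g ** x) y = d x (!g ** y).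
Proof. unfold dist. f_equal. grp_eq. Qed.

Lemma gprod_sym w x y : gp w x y = gp w y x.
Proof. unfold gprod. rewrite (dist_sym x y). lia. Qed.

Lemma gprod_mul g w x y : gp (g ** w) (g ** x) (g ** y) = gp w x y.
Proof. unfold gprod. now rewrite !dist_mul. Qed.

Lemma gprod_nonneg w x y : 0 <= gp w x y.
Proof. unfold gprod. pose proof (dist_tri x w y). rewrite (dist_sym x w) in *. lia. Qed.

Lemma gprod_le w x y : gp w x y <= 2 * d w x.
Proof.
  unfold gprod. pose proof (dist_tri w x y). lia.
Qed.

Lemma gprod_hyp w x y z : Z.min (gp w x z) (gp w z y) <= gp w x y + D.
Proof.
  unfold gprod. pose proof (four_point L x y w z) as H.
  rewrite (dist_sym x w), (dist_sym y w), (dist_sym y z) in H. lia.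
Qed.

Lemma gprod_move w x y y' : Z.abs (gp w x y - gp w x y') <= 2 * d y y'.
Proof.
  unfold gprod. pose proof (dist_tri w y y'). pose proof (dist_tri w y' y).
  pose proof (dist_tri x y y'). pose proof (dist_tri x y' y).
  rewrite (dist_sym y' y) in *. lia.
Qed.

Lemma gprod_swap x y z : gp x y z + gp y x z = 2 * d x y.
Proof.
  unfold gprod. rewrite (dist_sym y x). lia.
Qed.

Lemma geodesic_path p q : exists c : nat -> G,
  c 0%nat = p /\ c (Z.to_nat (d p q)) = q /\
  forall i j, (i <= j <= Z.to_nat (d p q))%nat -> d (c i) (c j) = Z.of_nat (j - i).
Proof.
  destruct (len_path L (!p ** q)) as [c [c0 [c1 H]]].
  exists (fun i => p ** c i). repeat split.
  - rewrite c0. grp_eq.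
  - unfold dist. rewrite c1. grp_eq.
  - intros i j Hij. rewrite dist_mul. now apply H.
Qed.

Lemma geodesic_point p q r : 0 <= r <= d p q ->
  exists z, d p z = r /\ d z q = d p q - r.
Proof.
  intros Hr. destruct (geodesic_path p q) as [c [c0 [c1 H]]].
  exists (c (Z.to_nat r)). split.
  - rewrite <- c0, H by lia. lia.
  - rewrite <- c1 at 1. rewrite H by lia. lia.
Qed.

(** The two assumed gains total [2 * k - D], more than [D], which rules out one term of the maximum
    in the four-point condition; the other term is the claim. *)
Lemma chain_step x0 x1 x2 x3 k : D < k ->
  d x0 x1 + k - D <= d x0 x2 -> d x2 x3 + k <= d x1 x3 ->
  d x0 x2 + d x1 x3 - d x1 x2 - D <= d x0 x3.
Proof.
  intros Hk H1 H2. pose proof (four_point L x0 x2 x1 x3).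
  rewrite (dist_sym x2 x1) in *. lia.
Qed.

(* The broken geodesic 1, st, stst, ... does not backtrack. *)
Lemma product_strong s t k : D < k ->
  gp gone (!s) t + k <= Z.min (len s) (len t) ->
  gp gone (!t) s + k <= Z.min (len s) (len t) ->
  len (s ** t) + len s + len t - gp gone (!s) t - gp gone (!t) s - 2 * D
    <= len ((s ** t) ^^ 2).
Proof.
  intros Hk H1 H2. unfold gprod in *. rewrite !dist_one in *.
  rewrite !(len_inv L) in *.
  assert (E2 : d (!s) t = len (s ** t)) by (unfold dist; f_equal; grp_eq).
  assert (E3 : d (!t) s = len (t ** s)) by (unfold dist; f_equal; grp_eq).
  rewrite E2, E3 in *.
  pose proof (chain_step gone s (s ** t) (s ** t ** s) k Hk) as A.
  pose proof (chain_step gone (s ** t) (s ** t ** s) (s ** t ** s ** t) k Hk) as B.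
  rewrite !dist_one in *.
  replace (d s (s ** t ** s)) with (len (t ** s)) in * by (unfold dist; f_equal; grp_eq).
  replace (d (s ** t) (s ** t ** s)) with (len s) in * by (unfold dist; f_equal; grp_eq).
  replace (d s (s ** t)) with (len t) in * by (unfold dist; f_equal; grp_eq).
  replace (d (s ** t) (s ** t ** s ** t)) with (len (s ** t)) in * by (unfold dist; f_equal; grp_eq).
  replace (d (s ** t ** s) (s ** t ** s ** t)) with (len t) in * by (unfold dist; f_equal; grp_eq).
  replace ((s ** t) ^^ 2) with (s ** t ** s ** t) by (cbn; grp_eq).
  pose proof (D_pos L). lia.
Qed.

(** The output of [chain_step] on consecutive powers is its first hypothesis one step later, so a
    gain of [k] at the square becomes a gain of [k - D] at every power. *)
Lemma strong_growth g k n : D < k -> len g + k <= len (g ^^ 2) ->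
  len (g ^^ n) + k - D <= len (g ^^ S n).
Proof.
  intros Hk H. induction n as [|n IH].
  - rewrite npow_1. cbn. rewrite (len_one L). pose proof (len_mul L g g).
    pose proof (D_pos L). cbn in H. rewrite gmul_1r in H. lia.
  - pose proof (chain_step gone (g ^^ n) (g ^^ S n) (g ^^ S (S n)) k Hk) as A.
    rewrite !dist_one in A.
    replace (d (g ^^ n) (g ^^ S (S n))) with (len (g ^^ 2)) in A.
    2:{ unfold dist. f_equal. replace (S (S n)) with (n + 2)%nat by lia. rewrite npow_add. grp_eq. }
    replace (d (g ^^ S n) (g ^^ S (S n))) with (len g) in A.
    2:{ unfold dist. f_equal. rewrite (npow_Sr g (S n)). grp_eq. }
    replace (d (g ^^ n) (g ^^ S n)) with (len g) in A.
    2:{ unfold dist. f_equal. rewrite (npow_Sr g n). grp_eq. }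
    lia.
Qed.

Lemma strong_growth_add g k n m : D < k -> len g + k <= len (g ^^ 2) ->
  len (g ^^ n) + Z.of_nat m * (k - D) <= len (g ^^ (n + m)).
Proof.
  intros Hk H. induction m as [|m IH]; [rewrite Nat.add_0_r; lia|].
  rewrite Nat.add_succ_r. pose proof (strong_growth g k (n + m) Hk H). lia.
Qed.

Lemma strong_growth_linear g k n : D < k -> len g + k <= len (g ^^ 2) ->
  Z.of_nat n * (k - D) <= len (g ^^ n).
Proof.
  intros Hk H. pose proof (strong_growth_add g k 0 n Hk H).
  cbn [Nat.add npow] in *. rewrite (len_one L) in *. lia.
Qed.

(** Seen from 1, positive powers start like [g] and negative ones like [!g], while these two share
    little; [gprod_hyp], used twice, combines the three facts. *)
Lemma strong_straight g k a b : 2 * D < k -> len g + k <= len (g ^^ 2) ->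
  gp gone (!(g ^^ a)) (g ^^ b) <= len g + 2 * D.
Proof.
  intros Hk H. pose proof (D_pos L). pose proof (len_nonneg L g).
  destruct a as [|a].
  { change (g ^^ 0) with (gone : G). unfold gprod. grp. rewrite dist_refl. lia. }
  destruct b as [|b].
  { change (g ^^ 0) with (gone : G). unfold gprod. rewrite dist_refl, (dist_sym (!(g ^^ S a)) gone). lia. }
  assert (Hb : len g + k - D <= gp gone (g ^^ S b) g).
  { pose proof (strong_growth g k b ltac:(lia) H) as K.
    unfold gprod. rewrite !dist_one, dist_sym.
    replace (d g (g ^^ S b)) with (len (g ^^ b)) by (unfold dist; f_equal; cbn; grp_eq). lia. }
  assert (Ha : len g + k - D <= gp gone (!g) (!(g ^^ S a))).
  { pose proof (strong_growth g k a ltac:(lia) H) as K.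
    unfold gprod. rewrite !dist_one, !(len_inv L).
    replace (d (!g) (!(g ^^ S a))) with (len (g ^^ a)).
    2:{ unfold dist. rewrite <- (len_inv L (g ^^ a)). f_equal.
        rewrite npow_Sr. grp_eq. }
    lia. }
  assert (Hm : gp gone (!g) g <= len g - k).
  { unfold gprod. rewrite !dist_one, (len_inv L).
    replace (d (!g) g) with (len (g ^^ 2)) by (unfold dist; f_equal; cbn; grp_eq). lia. }
  pose proof (gprod_hyp gone (!g) g (!(g ^^ S a))).
  pose proof (gprod_hyp gone (!(g ^^ S a)) g (g ^^ S b)).
  lia.
Qed.

(** * Points close to a geodesic, and isometries moving its ends a bounded amount *)

Section NearGeodesic.
Context (p q : G).

Lemma near_geodesic_dist e y y' : gp y p q <= e -> gp y' p q <= e ->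
  d y y' <= Z.abs (d p y - d p y') + e + D.
Proof.
  intros H H'. unfold gprod in *. pose proof (four_point L y y' p q).
  rewrite (dist_sym y p), (dist_sym y' p) in *. lia.
Qed.

(** Far from the ends, [g ** z] sees [g ** p] in the direction of [p] and [g ** q] in that of [q];
    replacing the two ends one after the other costs [D] each time. *)
Lemma near_geodesic_move A e g z : d p (g ** p) <= A -> d q (g ** q) <= A ->
  gp z p q <= e -> 2 * A + e + 2 * D < 2 * d p z -> 2 * A + e + 2 * D < 2 * d q z ->
  gp (g ** z) p q <= e + 2 * D.
Proof.
  intros Hp Hq He Hzp Hzq.
  pose proof (gprod_hyp (g ** z) (g ** p) (g ** q) p) as H1.
  pose proof (gprod_hyp (g ** z) p (g ** q) q) as H2.
  rewrite gprod_mul in *.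
  assert (K1 : 2 * d p z - 2 * A <= gp (g ** z) (g ** p) p).
  { unfold gprod. rewrite dist_mul, (dist_sym z p), (dist_sym (g ** p) p).
    pose proof (dist_tri (g ** z) p (g ** p)) as T. rewrite dist_mul in T.
    rewrite (dist_sym z p) in T. lia. }
  assert (K2 : 2 * d q z - 2 * A <= gp (g ** z) q (g ** q)).
  { unfold gprod. rewrite dist_mul, (dist_sym z q).
    pose proof (dist_tri (g ** z) q (g ** q)) as T. rewrite dist_mul in T.
    rewrite (dist_sym z q) in T. lia. }
  pose proof (D_pos L). lia.
Qed.

Lemma near_geodesic_shift A g z : d p (g ** p) <= A ->
  Z.abs (d p (g ** z) - d p z) <= A.
Proof.
  intros Hp. pose proof (dist_tri p (g ** p) (g ** z)) as T1.
  pose proof (dist_tri (g ** p) p (g ** z)) as T2.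
  rewrite (dist_sym (g ** p) p), dist_mul in *. lia.
Qed.

Lemma near_geodesic_displacement A e g z : d p (g ** p) <= A -> d q (g ** q) <= A ->
  gp z p q <= e -> 2 * A + e + 2 * D < 2 * d p z -> 2 * A + e + 2 * D < 2 * d q z ->
  d z (g ** z) <= A + e + 3 * D.
Proof.
  intros Hp Hq He Hzp Hzq. pose proof (D_pos L).
  pose proof (near_geodesic_move A e g z Hp Hq He Hzp Hzq).
  pose proof (near_geodesic_shift A g z Hp).
  pose proof (near_geodesic_dist (e + 2 * D) z (g ** z)). lia.
Qed.

(** In the four-point condition on p, gp, gz, gz' one pairing is excluded by distance; the other two
    compare the shift at [z] with the shift at [z']. *)
Lemma shift_constant A g z z' : d p (g ** p) <= A ->
  2 * A + d z z' + D < d p z + d p z' ->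
  Z.abs ((d p (g ** z) - d p z) - (d p (g ** z') - d p z')) <= D.
Proof.
  intros Hp Hz.
  pose proof (four_point L p (g ** z) (g ** p) (g ** z')) as F1.
  pose proof (four_point L p (g ** z') (g ** p) (g ** z)) as F2.
  pose proof (near_geodesic_shift A g z Hp).
  pose proof (near_geodesic_shift A g z' Hp).
  rewrite !dist_mul in *.
  rewrite (dist_sym z p), (dist_sym z' p) in *.
    rewrite (dist_sym z' z) in F2. lia.
Qed.

End NearGeodesic.
End Geometry.

(** * Acylindricity *)

Definition commutator {G : Group} (u v : G) : G := u ** v ** !u ** !v.

(** Being a family of inequations between words, this property is preserved by every injective
    endomorphism; the later constants are uniform in the automorphism for that reason. *)
Definition comm_independent {G : Group} (u v : G) : Prop :=
  forall j, (j > 0)%nat -> u ^^ j ** commutator u v <> commutator u v ** u ^^ j.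

Section Acylindricity.
Context {G : Group} {len : G -> Z} {D : Z} (L : hyp_length G len D).
Implicit Types x y z w p q g h s t u v : G.
Local Notation d := (dist len).
Local Notation gp := (gprod len).

Lemma displacement_mul p g h : d p (g ** h ** p) <= d p (g ** p) + d p (h ** p).
Proof.
  pose proof (dist_tri L p (g ** p) (g ** h ** p)) as T.
  rewrite gmul_assoc_r, (dist_mul g p (h ** p)) in T. rewrite gmul_assoc_r. lia.
Qed.

Lemma displacement_inv p g : d p (!g ** p) = d p (g ** p).
Proof. rewrite (dist_sym L), dist_mul_l, ginv_inv. reflexivity. Qed.

Lemma displacement_pow p g n A : d p (g ** p) <= A -> d p (g ^^ n ** p) <= Z.of_nat n * A.
Proof.
  intro H. induction n as [|n IH].
  - cbn. rewrite gmul_1l, (dist_refl L). lia.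
  - rewrite npow_S. pose proof (displacement_mul p g (g ^^ n)). lia.
Qed.

(* Along the middle of [p,q] both isometries are, up to a multiple of D, translations by
   constant amounts, so the commutator and all its conjugates by small powers of u move
   one and the same point by at most 9D: two of these conjugates coincide. *)
Lemma acylindrical : exists B, 0 <= B /\ forall u v p q A, D <= A ->
  d p (u ** p) <= A -> d q (u ** q) <= A ->
  d p (v ** p) <= A -> d q (v ** q) <= A ->
  B * A <= d p q -> ~ comm_independent u v.
Proof.
  destruct (len_ball L (9 * D)) as [l Hl].
  pose proof (D_pos L) as HD.
  remember (Z.of_nat (length l)) as b eqn:Hb.
  exists (4 * b + 100). split; [lia|].
  intros u v p q A HDA Hup Huq Hvp Hvq Hpq Hind.
  (* [A'] bounds the displacement of every [g i] below at both ends: the two factors around the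
     power cost [4 * A], the power at most [b * A]. *)
  assert (exists A', A' = b * A + 6 * A) as [A' HA'] by eauto.
  assert (HbA : 0 <= b * A) by nia.
  destruct (floor_div (d p q) 2 ltac:(lia)) as [r0 Hr0].
  destruct (geodesic_point L p q r0) as [m [Hpm Hmq]].
  { pose proof (dist_nonneg L p q). lia. }
  assert (Hm : gp m p q <= 0).
  { unfold gprod. rewrite (dist_sym L m p), Hpm, Hmq. lia. }
  assert (Hpm' : A' + 20 * A <= d p m) by lia.
  assert (Hqm' : A' + 20 * A <= d q m) by (rewrite (dist_sym L q m); lia).
  clear Hpm Hmq.
  (* Put n = [g i] m. Then v u n = u^i v u m, so the distance from v u n to u v n is the length of a
     conjugate of the commutator in which only u^i depends on [i]. *)
  set (g := fun i => !(v ** u) ** u ^^ i ** (v ** u)).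
  assert (Hg : forall r i, (i <= length l)%nat -> d r (u ** r) <= A -> d r (v ** r) <= A ->
    d r (g i ** r) <= A').
  { intros r i Hi Hu Hv. unfold g.
    pose proof (displacement_mul r (!(v ** u) ** u ^^ i) (v ** u)).
    pose proof (displacement_mul r (!(v ** u)) (u ^^ i)).
    pose proof (displacement_inv r (v ** u)).
    pose proof (displacement_mul r v u).
    pose proof (displacement_pow r u i A Hu).
    assert (Z.of_nat i * A <= b * A) by (apply Z.mul_le_mono_nonneg_r; lia).
    lia. }
  destruct (pigeonhole (fun i => !(v ** u ** m) ** !(u ^^ i) ** commutator u v ** u ^^ i ** (v ** u ** m)) l)
    as [i [j [Hij E]]].
  - intros i Hi. apply Hl.
    pose proof (near_geodesic_move L p q A' 0 (g i) m) as M0.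
    pose proof (near_geodesic_shift L p A' (g i) m) as S0.
    pose proof (near_geodesic_shift L q A' (g i) m) as S0'.
    specialize (Hg p i Hi Hup Hvp) as Hgp. specialize (Hg q i Hi Huq Hvq) as Hgq.
    specialize (M0 Hgp Hgq Hm ltac:(lia) ltac:(lia)).
    specialize (S0 Hgp). specialize (S0' Hgq).
    set (n := g i ** m) in *.
    assert (Hpn : 20 * A <= d p n) by lia.
    assert (Hqn : 20 * A <= d q n) by lia.
    pose proof (near_geodesic_move L p q A (0 + 2 * D) u n Hup Huq M0 ltac:(lia) ltac:(lia)) as Mu.
    pose proof (near_geodesic_move L p q A (0 + 2 * D) v n Hvp Hvq M0 ltac:(lia) ltac:(lia)) as Mv.
    pose proof (near_geodesic_displacement L p q A (0 + 2 * D) u n Hup Huq M0 ltac:(lia) ltac:(lia)) as Du.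
    pose proof (near_geodesic_displacement L p q A (0 + 2 * D) v n Hvp Hvq M0 ltac:(lia) ltac:(lia)) as Dv.
    pose proof (near_geodesic_shift L p A u n Hup) as Su.
    pose proof (near_geodesic_shift L p A v n Hvp) as Sv.
    pose proof (near_geodesic_shift L q A u n Huq) as Su'.
    pose proof (near_geodesic_shift L q A v n Hvq) as Sv'.
    pose proof (near_geodesic_move L p q A (0 + 2 * D + 2 * D) v (u ** n) Hvp Hvq Mu
      ltac:(lia) ltac:(lia)) as Mvu.
    pose proof (near_geodesic_move L p q A (0 + 2 * D + 2 * D) u (v ** n) Hup Huq Mv
      ltac:(lia) ltac:(lia)) as Muv.
    pose proof (shift_constant L p A u n (v ** n) Hup ltac:(lia)) as Cu.
    pose proof (shift_constant L p A v n (u ** n) Hvp ltac:(lia)) as Cv.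
    pose proof (near_geodesic_dist L p q (0 + 2 * D + 2 * D + 2 * D) _ _ Mvu Muv) as F.
    replace (!(v ** u ** m) ** !(u ^^ i) ** commutator u v ** u ^^ i ** (v ** u ** m))
      with (!(v ** (u ** n)) ** (u ** (v ** n))).
    (* [Cu] and [Cv] contribute [2 * D] through the distances to [p], and [F] adds [6 * D + D]. *)
    + change (d (v ** (u ** n)) (u ** (v ** n)) <= 9 * D). lia.
    + unfold n, g, commutator. grp_eq.
  - apply (Hind (j - i)%nat); [lia|].
    replace j with ((j - i) + i)%nat in E by lia. rewrite npow_add in E.
    set (k := (j - i)%nat) in *. set (c := commutator u v) in *.
    apply gmul_cancel_r in E. revert E. grp. intro E.
    apply gmul_cancel_l, gmul_cancel_l, gmul_cancel_l, gmul_cancel_l in E.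
    rewrite !gmul_assoc in E. apply gmul_cancel_r in E.
    rewrite E at 1. grp_eq.
Qed.

(** Commuting with [U], the element [u] moves both 1 and [U] by at most [A], hence also the inner
    points of [1,U]; likewise for [v] and [1,V]. A long common part would then be moved little by
    both, against [acylindrical]. *)
Lemma overlap_bound : exists M, 0 <= M /\ forall u v U V A, D <= A ->
  len u <= A -> len v <= A -> u ** U = U ** u -> v ** V = V ** v ->
  comm_independent u v -> gp gone U V <= M * A.
Proof.
  destruct acylindrical as [B [HB HAc]]. pose proof (D_pos L) as HD.
  exists (10 * B + 40). split; [lia|].
  intros u v U V A HA Hu Hv HU HV Hind.
  destruct (Z.le_gt_cases (gp gone U V) ((10 * B + 40) * A)) as [|Hbig]; [trivial|exfalso].
  assert (HBA : 0 <= B * A) by nia.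
  (* Inner points move by at most [A + D + 3 * D], so [acylindrical] is applied with [5 * A]; the
     surplus [10 * A] keeps [q] far from 1. *)
  set (r := 5 * (B * A) + 10 * A).
  assert (Hr : 2 * r + 20 * A < gp gone U V) by (unfold r; lia).
  pose proof (gprod_le L gone U V) as LU.
  pose proof (gprod_le L gone V U) as LV. rewrite (gprod_sym L gone V U) in LV.
  destruct (geodesic_point L gone U r) as [q [Hq HqU]]; [unfold r in *; lia|].
  assert (HqV : d q V <= len V - r + D).
  { unfold gprod in Hr, LU, LV. rewrite !dist_one in *.
    pose proof (four_point L q V gone U) as F.
    rewrite (dist_sym L q gone), dist_one, dist_one, (dist_sym L V gone), dist_one,
      (dist_sym L V U) in F. lia. }
  assert (Hu1 : d gone (u ** gone) <= A) by (rewrite gmul_1r, dist_one; trivial).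
  assert (Hv1 : d gone (v ** gone) <= A) by (rewrite gmul_1r, dist_one; trivial).
  assert (HuU : d U (u ** U) <= A) by (rewrite HU, dist_mul_r; trivial).
  assert (HvV : d V (v ** V) <= A) by (rewrite HV, dist_mul_r; trivial).
  rewrite !dist_one in Hq, LU, LV, HqU.
  pose proof (near_geodesic_displacement L gone U A D u q Hu1 HuU) as Du.
  pose proof (near_geodesic_displacement L gone V A D v q Hv1 HvV) as Dv.
  unfold gprod in Du, Dv. rewrite (dist_sym L q gone), !dist_one in Du, Dv.
  rewrite (dist_sym L U q) in Du. rewrite (dist_sym L V q) in Dv.
  pose proof (dist_tri L gone q V) as T. rewrite !dist_one in T.
  specialize (Du ltac:(lia) ltac:(lia) ltac:(lia)).
  specialize (Dv ltac:(lia) ltac:(lia) ltac:(lia)).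
  apply (HAc u v gone q (5 * A)); try lia; trivial.
  rewrite dist_one. lia.
Qed.

End Acylindricity.

(** * Gromov products under quasi-isometries *)

Section QuasiIsometry.
Context {G : Group} {len : G -> Z} {D : Z} (L : hyp_length G len D).
Implicit Types x y z w p q : G.
Local Notation d := (dist len).
Local Notation gp := (gprod len).

(** Halving the chain repeatedly, [gprod_hyp] loses [D] at each of [k] levels: the loss is
    logarithmic in the number of links. *)
Lemma gprod_chain w T k n (y : nat -> G) : (1 <= n <= 2 ^ k)%nat ->
  (forall i, (i < n)%nat -> T <= gp w (y i) (y (S i))) ->
  T - Z.of_nat k * D <= gp w (y 0%nat) (y n).
Proof.
  revert n y. induction k as [|k IH]; intros n y Hn Hy.
  - replace n with 1%nat by (cbn in Hn; lia). specialize (Hy 0%nat). lia.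
  - pose proof (D_pos L) as HD. rewrite Nat.pow_succ_r' in Hn.
    destruct (Nat.le_gt_cases n (2 ^ k)) as [H|H].
    + specialize (IH n y ltac:(lia) Hy). lia.
    + pose proof (IH (2 ^ k)%nat y ltac:(lia) ltac:(intros; apply Hy; lia)) as A.
      pose proof (IH (n - 2 ^ k)%nat (fun i => y (2 ^ k + i)%nat) ltac:(lia)) as B.
      cbv beta in B. rewrite Nat.add_0_r in B.
      replace (2 ^ k + (n - 2 ^ k))%nat with n in B by lia.
      assert (B' : T - Z.of_nat k * D <= gp w (y (2 ^ k)%nat) (y n)).
      { apply B. intros i Hi. rewrite Nat.add_succ_r. apply Hy. lia. }
      pose proof (gprod_hyp L w (y 0%nat) (y n) (y (2 ^ k)%nat)). lia.
Qed.

Lemma linear_lt_pow2 (a : nat) : exists n0, forall n, (n0 <= n)%nat -> (a * n <= 2 ^ n)%nat.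
Proof.
  assert (H2 : forall n, (4 <= n -> n * n <= 2 ^ n)%nat).
  { intros n Hn. induction Hn as [|n Hn IH]; [cbn; lia|].
    rewrite Nat.pow_succ_r'. nia. }
  exists (a + 4)%nat. intros n Hn. specialize (H2 n ltac:(lia)). nia.
Qed.

(** With [k] the integer quotient of [E] by [D], the product [k * D] stays at most [E], while 2^k
    outgrows every linear function of [E]. *)
Lemma log_vs_linear (K c : Z) : 0 <= K -> exists E0, 0 <= E0 /\ forall E, E0 <= E -> exists k,
  K * E <= Z.of_nat (2 ^ k) /\ c + Z.of_nat k * D < 2 * E.
Proof.
  intro HK. pose proof (D_pos L) as HD.
  destruct (linear_lt_pow2 (Z.to_nat (K * D * 2))) as [n0 Hn0].
  exists (Z.max (Z.max 1 (c + 1)) (D * (Z.of_nat n0 + 1))). split; [nia|].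
  intros E HE. destruct (floor_div E D ltac:(lia)) as [r Hr].
  assert (Hr0 : Z.of_nat n0 <= r /\ 1 <= r + 1) by nia.
  exists (Z.to_nat r). split; [|lia].
  destruct (Z.le_gt_cases r 0) as [Hz|Hz].
  - assert (r = 0) by lia. subst r. specialize (Hn0 1%nat).
    specialize (Hn0 ltac:(lia)). assert (K * E <= K * D) by nia.
    assert (K * D * 2 <= 2) by (cbn in Hn0; lia). cbn. lia.
  - specialize (Hn0 (Z.to_nat r) ltac:(lia)).
    apply inj_le in Hn0. rewrite Nat2Z.inj_mul, !Z2Nat.id in Hn0 by nia.
    assert (K * E <= K * (D * r + D)) by nia.
    assert (K * (D * r + D) <= K * D * 2 * r) by nia. lia.
Qed.

Context (th : G -> G) (K : Z) (HK : 1 <= K)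
  (Hup : forall x y, d (th x) (th y) <= K * d x y)
  (Hlow : forall x y, d x y <= K * d (th x) (th y)).

(* The easy half of the Morse lemma: at the point of the geodesic farthest from the image
   path, a detour of linear length would have to avoid a ball of linear radius. *)
Lemma geodesic_near_image : exists E, 0 <= E /\ forall x y z, gp z (th x) (th y) = 0 ->
  exists w, gp w x y = 0 /\ d z (th w) <= E.
Proof.
  pose proof (D_pos L) as HD.
  destruct (log_vs_linear (6 * K) (K + 2 * D) ltac:(lia)) as [E0 [HE0 HE]].
  exists (E0 + 1). split; [lia|]. intros x y z0 Hz0.
  destruct (geodesic_path L x y) as [c [c0 [c1 Hc]]].
  set (n := Z.to_nat (d x y)) in *.
  assert (Hon : forall i, (i <= n)%nat -> gp (c i) x y = 0).
  { intros i Hi. unfold gprod. rewrite <- c0 at 1. rewrite <- c1 at 1.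
    rewrite (dist_sym L (c i) (c 0%nat)), !Hc by lia.
    pose proof (dist_nonneg L x y). lia. }
  set (Q := fun e => exists z, gp z (th x) (th y) = 0 /\
    forall i, (i <= n)%nat -> Z.of_nat e <= d z (th (c i))).
  destruct (nat_greatest Q (Z.to_nat (d (th x) (th y)))) as [e [[z [Hz He]] Hmax]].
  - exists 0%nat, z0. split; trivial. intros i _. apply (dist_nonneg L).
  - intros e [z [Hz He]]. specialize (He 0%nat ltac:(lia)). rewrite c0 in He.
    unfold gprod in Hz. pose proof (dist_nonneg L z (th y)). lia.
  - assert (Hall : forall z', gp z' (th x) (th y) = 0 ->
      exists i, (i <= n)%nat /\ d z' (th (c i)) <= Z.of_nat e).
    { intros z' Hz'. apply NNPP. intro N.
      assert (Q (S e)) as HQ.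
      { exists z'. split; trivial. intros i Hi.
        destruct (Z.le_gt_cases (d z' (th (c i))) (Z.of_nat e)); [destruct N; eauto|lia]. }
      apply Hmax in HQ. lia. }
    destruct (Z.le_gt_cases (Z.of_nat e) E0) as [Hs|Hs].
    { destruct (Hall z0 Hz0) as [i [Hi Hd]]. exists (c i). split; [now apply Hon|lia]. }
    exfalso. destruct (HE (Z.of_nat e) ltac:(lia)) as [k [Hk1 Hk2]].
    (* On each side of [z], take the point at distance 2e, or the end if that is nearer. It is
       within [e] of the image path, all of which is at distance at least [e] from [z]. *)
    assert (Hside : forall r o i0, (i0 <= n)%nat -> th (c i0) = r -> gp z r o = 0 ->
      (forall z', gp z' r o = 0 -> gp z' (th x) (th y) = 0) ->
      exists w i, (i <= n)%nat /\ d r w + d z w = d z r /\ d z w <= 2 * Z.of_nat e /\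
        d w (th (c i)) <= Z.of_nat e /\ 2 * Z.of_nat e <= gp z w (th (c i))).
    { intros r o i0 Hi0 Hr Hro Hback. pose proof (He i0 Hi0) as Hei. rewrite Hr in Hei.
      destruct (Z.le_gt_cases (d z r) (2 * Z.of_nat e)) as [Hle|Hgt].
      - exists r, i0. unfold gprod. rewrite Hr, !(dist_refl L). lia.
      - destruct (geodesic_point L z r (2 * Z.of_nat e) ltac:(lia)) as [w [Hw1 Hw2]].
        destruct (Hall w) as [i [Hi Hd]].
        { apply Hback. pose proof (gprod_nonneg L w r o). unfold gprod in *.
          pose proof (dist_tri L w z o). rewrite (dist_sym L w z) in *. lia. }
        exists w, i. specialize (He i Hi). unfold gprod. rewrite (dist_sym L r w). lia. }
    destruct (Hside (th x) (th y) 0%nat) as [w1 [i [Hi [A1 [A2 [A3 A4]]]]]];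
      [lia|now rewrite c0|trivial|trivial|].
    destruct (Hside (th y) (th x) n) as [w2 [j [Hj [B1 [B2 [B3 B4]]]]]];
      [lia|now rewrite c1|now rewrite gprod_sym by exact L| |].
    { intros z'. now rewrite (gprod_sym L). }
    assert (Hw : gp z w1 w2 = 0).
    { pose proof (gprod_nonneg L z w1 w2). unfold gprod in *.
      pose proof (dist_tri L (th x) w1 (th y)). pose proof (dist_tri L w1 w2 (th y)).
      rewrite (dist_sym L w2 (th y)) in *. lia. }
    (* Consecutive points of the image path are at most [K] apart and at least [e] away from [z], so
       their products are at least 2e - K. *)
    assert (Hchain : forall a b, (a < b <= n)%nat -> Z.of_nat (b - a) <= Z.of_nat (2 ^ k) ->
      2 * Z.of_nat e - K - Z.of_nat k * D <= gp z (th (c a)) (th (c b))).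
    { intros a b Hab Hlen.
      pose proof (gprod_chain z (2 * Z.of_nat e - K) k (b - a) (fun m => th (c (a + m)%nat))) as C.
      cbv beta in C. rewrite Nat.add_0_r in C.
      replace (a + (b - a))%nat with b in C by lia. apply C; [lia|].
      intros m Hm. unfold gprod. pose proof (He (a + m)%nat ltac:(lia)).
      pose proof (He (a + S m)%nat ltac:(lia)).
      pose proof (Hup (c (a + m)%nat) (c (a + S m)%nat)) as U.
      rewrite Hc in U by lia. replace (a + S m - (a + m))%nat with 1%nat in U by lia. lia. }
    (* The route through [w1], [z], [w2] has length e + 2e + 2e + e; by [Hlow] the indices then
       differ by at most 6Ke, hence by at most 2^k. *)
    assert (Hij : d (th (c i)) (th (c j)) <= 6 * Z.of_nat e).
    { pose proof (dist_tri L (th (c i)) w1 (th (c j))). pose proof (dist_tri L w1 w2 (th (c j))).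
      pose proof (dist_tri L w1 z w2). rewrite (dist_sym L (th (c i)) w1), (dist_sym L w1 z) in *. lia. }
    assert (Hgp : 2 * Z.of_nat e - K - Z.of_nat k * D <= gp z (th (c i)) (th (c j))).
    { pose proof (Hlow (c i) (c j)) as Lo.
      destruct (Nat.lt_trichotomy i j) as [H|[<-|H]].
      - apply Hchain; [lia|]. rewrite Hc in Lo by lia. nia.
      - unfold gprod. rewrite (dist_refl L). pose proof (He i Hi). nia.
      - rewrite (gprod_sym L). apply Hchain; [lia|].
        rewrite (dist_sym L), Hc in Lo by lia. nia. }
    pose proof (gprod_hyp L z w1 w2 (th (c i))).
    pose proof (gprod_hyp L z (th (c i)) w2 (th (c j))).
    rewrite (gprod_sym L z (th (c j)) w2) in *. lia.
Qed.

(** The point [z] of [th x, th y] facing [th p] is at distance at most about half the doubled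
    product from it. [geodesic_near_image] brings [z] back to a point [w] of [x,y], and [gp p x y]
    is at most [2 * d p w]. *)
Lemma gprod_quasi_isometry : exists C, 0 <= C /\ forall p x y,
  gp p x y <= K * gp (th p) (th x) (th y) + C.
Proof.
  pose proof (D_pos L) as HD.
  destruct geodesic_near_image as [E [HE HEx]].
  exists (K * (2 + 2 * D + 2 * E)). split; [nia|]. intros p x y.
  destruct (floor_div (gp (th x) (th p) (th y)) 2 ltac:(lia)) as [r Hr].
  pose proof (gprod_nonneg L (th x) (th p) (th y)).
  destruct (geodesic_point L (th x) (th y) r) as [z [Hz1 Hz2]].
  { pose proof (gprod_le L (th x) (th y) (th p)).
    rewrite (gprod_sym L (th x) (th y)) in *. lia. }
  destruct (HEx x y z) as [w [Hw Hzw]].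
  { unfold gprod. rewrite (dist_sym L z). lia. }
  pose proof (four_point L (th p) z (th x) (th y)) as F.
  pose proof (Hlow p w) as Hpw. pose proof (dist_tri L (th p) z (th w)) as T.
  assert (Hg : 2 * d (th p) z <= gp (th p) (th x) (th y) + 2 + 2 * D).
  { unfold gprod in *. rewrite (dist_sym L z (th x)) in F.
    rewrite (dist_sym L (th x) (th p)) in *. lia. }
  assert (Hle : gp p x y <= 2 * d p w).
  { unfold gprod in *. pose proof (dist_tri L p w x). pose proof (dist_tri L p w y). lia. }
  assert (K * d (th p) (th w) <= K * (d (th p) z + E)) by (apply Z.mul_le_mono_nonneg_l; lia).
  assert (K * (2 * d (th p) z) <= K * (gp (th p) (th x) (th y) + 2 + 2 * D))
    by (apply Z.mul_le_mono_nonneg_l; lia).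
  lia.
Qed.

End QuasiIsometry.

(** * Minimal displacement *)

Definition short_products {G : Group} (F : list G) : list G :=
  F ++ map (fun p => fst p ** snd p) (list_prod F F).

Lemma in_short_products {G : Group} (F : list G) g :
  In g (short_products F) <-> In g F \/ exists s t, In s F /\ In t F /\ g = s ** t.
Proof.
  unfold short_products. rewrite in_app_iff, in_map_iff. split.
  - intros [H|[[s t] [<- H]]]; [now left|]. apply in_prod_iff in H. right. cbn. exists s, t. tauto.
  - intros [H|[s [t [Hs [Ht ->]]]]]; [now left|]. right. exists (s, t).
    split; [reflexivity|now apply in_prod].
Qed.

Section MinimalDisplacement.
Context {G : Group} {len : G -> Z} {D : Z} (L : hyp_length G len D).
Implicit Types x y z w p q g h s t u v : G.
Local Notation d := (dist len).
Local Notation gp := (gprod len).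

(* If no product of at most two elements translates, all the segments [1,s] and [1,s^-1] with s
   long start in the same direction, and moving the base point that way shortens them all. *)
Lemma strong_element (F : list G) (mu : Z) : 100 * D <= mu ->
  (forall s, In s F -> len s <= mu) ->
  (forall p, exists s, In s F /\ mu <= d p (s ** p)) ->
  exists g, In g (short_products F) /\ 8 * len g + mu <= 8 * len (g ^^ 2).
Proof.
  intros Hmu Hle Hmin. pose proof (D_pos L) as HD.
  apply NNPP. intro N.
  assert (Hno : forall g, In g (short_products F) -> 8 * len (g ^^ 2) < 8 * len g + mu).
  { intros g Hg. destruct (Z.le_gt_cases (8 * len g + mu) (8 * len (g ^^ 2))); [|lia].
    destruct N. eauto. }
  clear N.
  assert (Hback : forall s, In s F -> 8 * len s - mu < 8 * gp gone s (!s)).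
  { intros s Hs. assert (K : In s (short_products F)) by (apply in_short_products; auto).
    apply Hno in K. rewrite gprod_sym by exact L. unfold gprod. rewrite !dist_one, (len_inv L).
    replace (d (!s) s) with (len (s ^^ 2)) by (unfold dist; f_equal; cbn; grp_eq). lia. }
  destruct (Hmin gone) as [s0 [Hs0 Hs0l]].
  rewrite gmul_1r, dist_one in Hs0l.
  assert (Hs0e : len s0 = mu) by (specialize (Hle s0 Hs0); lia). clear Hs0l.
  destruct (floor_div mu 8 ltac:(lia)) as [r Hr].
  destruct (geodesic_point L gone s0 r) as [p [Hp1 Hp2]]; [rewrite dist_one; lia|].
  rewrite dist_one in *.
  destruct (Hmin p) as [t [Ht Htp]].
  pose proof (Hle t Ht) as Htl.
  assert (Hdir : mu <= 2 * len t ->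
    8 * len t - mu - 24 * D <= 8 * gp gone s0 t /\
    8 * len t - mu - 24 * D <= 8 * gp gone s0 (!t)).
  { intro Hlong.
    pose proof (Hback s0 Hs0) as B0. pose proof (Hback t Ht) as Bt.
    assert (K : In (s0 ** t) (short_products F)) by (apply in_short_products; eauto 6).
    apply Hno in K.
    pose proof (product_strong L s0 t) as P.
    pose proof (gprod_hyp L gone s0 t (!s0)) as G1.
    pose proof (gprod_hyp L gone s0 (!t) (!s0)) as G2.
    pose proof (gprod_hyp L gone s0 t (!t)) as G3.
    pose proof (gprod_hyp L gone s0 (!t) t) as G4.
    pose proof (gprod_hyp L gone (!s0) t s0) as G5.
    pose proof (gprod_hyp L gone (!s0) (!t) s0) as G6.
    pose proof (gprod_hyp L gone (!s0) t (!t)) as G7.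
    rewrite (gprod_sym L gone (!t) t) in *.
    rewrite (gprod_sym L gone (!t) s0) in *.
    rewrite (gprod_sym L gone (!s0) s0) in *.
    destruct (Z.le_gt_cases (8 * len t - mu - 24 * D) (8 * gp gone s0 t)) as [X1|X1];
    destruct (Z.le_gt_cases (8 * len t - mu - 24 * D) (8 * gp gone s0 (!t))) as [X2|X2];
      try (split; assumption); exfalso.
    all: specialize (P (D + 1)); lia. }
  pose proof (dist_tri L p gone (t ** p)) as T1.
  pose proof (dist_tri L gone t (t ** p)) as T2.
  rewrite (dist_sym L p gone) in T1. rewrite !dist_one in T1, T2. rewrite dist_mul_r in T2.
  destruct (Z.le_gt_cases mu (2 * len t)) as [Hlong|]; [|lia].
  destruct (Hdir Hlong) as [H1 H2].
  assert (Hnear : forall x, len x = len t -> 8 * len t - mu - 24 * D <= 8 * gp gone s0 x ->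
    d p x <= len t - r + D).
  { intros x Hx Hg. pose proof (four_point L p x gone s0) as F1.
    unfold gprod in Hg. rewrite (dist_sym L p gone), (dist_sym L x gone), (dist_sym L x s0) in F1.
    rewrite !dist_one in *. lia. }
  pose proof (Hnear t eq_refl H1) as N1.
  pose proof (Hnear (!t) (len_inv L t) H2) as N2.
  pose proof (four_point L p (t ** p) gone t) as F1.
  rewrite (dist_sym L p gone), (dist_sym L (t ** p) t), (dist_sym L (t ** p) gone) in F1.
  rewrite dist_mul_r, !dist_one in F1.
  replace (len (t ** p)) with (d p (!t)) in F1.
  2:{ unfold dist. rewrite <- (len_inv L). f_equal. grp_eq. }
  lia.
Qed.

Lemma minimal_displacement (F : list G) : F <> nil -> exists p (mu : Z), 0 <= mu /\
  (forall s, In s F -> d p (s ** p) <= mu) /\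
  (forall q, exists s, In s F /\ mu <= d q (s ** q)).
Proof.
  intro HF.
  destruct (nat_least (fun n => exists p, forall s, In s F -> d p (s ** p) <= Z.of_nat n))
    as [n [[p Hp] Hmin]].
  - clear HF. enough (H : exists n : nat, forall s, In s F -> d gone (s ** gone) <= Z.of_nat n)
      by (destruct H as [n H]; eauto).
    induction F as [|s F [n Hn]].
    + now exists 0%nat.
    + exists (n + Z.to_nat (d gone (s ** gone)))%nat.
      intros t [<-|Ht]; [lia|]. specialize (Hn t Ht). lia.
  - exists p, (Z.of_nat n). split; [lia|]. split; trivial.
    intro q. apply NNPP. intro N.
    assert (Hlt : forall s, In s F -> d q (s ** q) < Z.of_nat n).
    { intros s Hs. destruct (Z.le_gt_cases (Z.of_nat n) (d q (s ** q))); [|lia].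
      destruct N. eauto. }
    destruct F as [|s F]; [congruence|].
    destruct n as [|n].
    + specialize (Hlt s (or_introl eq_refl)). pose proof (dist_nonneg L q (s ** q)). lia.
    + assert (S n <= n)%nat; [|lia]. apply Hmin. exists q. intros s' Hs'.
      specialize (Hlt s' Hs'). lia.
Qed.

(** Conjugation by [p] injects the elements moving [p] by at most [mu] into the ball of radius [mu],
    so [N] can be read off the ball of radius [100 * D], whatever [p] is. *)
Lemma displacement_large : exists N, forall (F : list G) mu p,
  NoDup F -> (N < length F)%nat -> (forall s, In s F -> d p (s ** p) <= mu) -> 100 * D <= mu.
Proof.
  destruct (len_ball L (100 * D)) as [l Hl]. exists (length l).
  intros F mu p HF HN H. apply Z.nlt_ge. intro Hlt.
  assert (ND : NoDup (map (fun s => !p ** s ** p) F)).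
  { apply NoDup_map_NoDup_ForallPairs; trivial. intros x y _ _ E.
    apply gmul_cancel_r, gmul_cancel_l in E. exact E. }
  apply NoDup_incl_length with (l' := l) in ND.
  - rewrite length_map in ND. lia.
  - intros x Hx. apply in_map_iff in Hx. destruct Hx as [s [<- Hs]].
    apply Hl. specialize (H s Hs). unfold dist in H. rewrite gmul_assoc in H. lia.
Qed.

End MinimalDisplacement.

(** * Elements of infinite order and commensurability *)

Lemma npow_conj_inv {G : Group} (t a : G) n : (!t ** a ** t) ^^ n = !t ** a ^^ n ** t.
Proof. pose proof (npow_conj (!t) a n) as H. now rewrite ginv_inv in H. Qed.

Definition is_power {G : Group} (w x : G) : Prop :=
  exists k, x = w ^^ k \/ x = !(w ^^ k).

Lemma is_power_inv {G : Group} (w x : G) : is_power w x -> is_power w (!x).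
Proof. intros [k [->| ->]]; exists k; rewrite ?ginv_inv; auto. Qed.

Lemma is_power_mul {G : Group} (w x y : G) : is_power w x -> is_power w y -> is_power w (x ** y).
Proof.
  assert (H : forall i j, is_power w (w ^^ i ** !(w ^^ j))).
  { intros i j. destruct (Nat.le_ge_cases i j) as [Hij|Hij].
    - exists (j - i)%nat. right. rewrite npow_sub by trivial. grp_eq.
    - exists (i - j)%nat. left. now rewrite npow_sub. }
  assert (C : forall i j, !(w ^^ i) ** w ^^ j = w ^^ j ** !(w ^^ i)).
  { intros i j. symmetry. apply comm_inv_r, npow_comm. symmetry. now apply npow_comm. }
  intros [i [->| ->]] [j [->| ->]].
  - exists (i + j)%nat. left. now rewrite npow_add.
  - apply H.
  - rewrite C. apply H.
  - exists (j + i)%nat. right. now rewrite npow_add, ginv_mul.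
Qed.

Lemma is_power_zpow {G : Group} (w x : G) : is_power w x -> exists z, x = zpow G w z.
Proof.
  intros [[|k] [->| ->]].
  - now exists 0.
  - exists 0. cbn. grp_eq.
  - exists (Zpos (Pos.of_succ_nat k)). cbn [zpow]. now rewrite SuccNat2Pos.id_succ.
  - exists (Zneg (Pos.of_succ_nat k)). cbn [zpow]. now rewrite SuccNat2Pos.id_succ.
Qed.

Definition up_to_sign {G : Group} (x y : G) : Prop := x = y \/ x = !y.

Lemma up_to_sign_pow {G : Group} (x y : G) n : up_to_sign x y -> up_to_sign (x ^^ n) (y ^^ n).
Proof. intros [->| ->]; [now left|right; apply npow_inv]. Qed.

Lemma up_to_sign_conj {G : Group} (t x y : G) :
  up_to_sign x y -> up_to_sign (t ** x ** !t) (t ** y ** !t).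
Proof. intros [->| ->]; [now left|right; grp_eq]. Qed.

Lemma up_to_sign_sym {G : Group} (x y : G) : up_to_sign x y -> up_to_sign y x.
Proof. intros [->| ->]; [now left|right; grp_eq]. Qed.

Lemma up_to_sign_trans {G : Group} (x y z : G) :
  up_to_sign x y -> up_to_sign y z -> up_to_sign x z.
Proof. intros [->| ->] [->| ->]; unfold up_to_sign; grp; auto. Qed.

(** The sign admits elements that exchange the two ends of the axis of [w]. *)
Definition normalizes_power {G : Group} (w x : G) : Prop :=
  exists j, (j > 0)%nat /\ up_to_sign (x ** w ^^ j ** !x) (w ^^ j).

Lemma normalizes_power_pow {G : Group} (w x : G) n :
  normalizes_power w x -> normalizes_power w (x ^^ n).
Proof.
  intros [j [Hj H]]. exists j. split; trivial. induction n as [|n IH].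
  - left. cbn. grp_eq.
  - apply up_to_sign_trans with (x ** w ^^ j ** !x); trivial.
    apply (up_to_sign_conj x) in IH.
    replace (x ^^ S n ** w ^^ j ** !(x ^^ S n)) with (x ** (x ^^ n ** w ^^ j ** !(x ^^ n)) ** !x);
      [trivial|cbn; grp_eq].
Qed.

Definition commensurable {G : Group} (u v : G) : Prop :=
  exists m n, (m > 0)%nat /\ (n > 0)%nat /\ up_to_sign (u ^^ m) (v ^^ n).

Lemma commensurable_sym {G : Group} (u v : G) : commensurable u v -> commensurable v u.
Proof. intros [m [n [Hm [Hn H]]]]. exists n, m. auto using up_to_sign_sym. Qed.

Lemma choose_function {A B : Type} (R : A -> B -> Prop) :
  (forall a, exists b, R a b) -> exists f, forall a, R a (f a).
Proof.
  intro H. exists (fun a => proj1_sig (constructive_indefinite_description _ (H a))).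
  intro a. apply proj2_sig.
Qed.

Section AxialElements.
Context {G : Group} {len : G -> Z} {D : Z} (L : hyp_length G len D).
Implicit Types x y z w p q g h s t u v o : G.
Local Notation d := (dist len).
Local Notation gp := (gprod len).

(** The gain [2 * D + 1] is the least that [strong_straight] accepts. *)
Definition axial w : Prop := len w + (2 * D + 1) <= len (w ^^ 2).

Lemma axial_growth w n m : axial w -> len (w ^^ n) + Z.of_nat m * (D + 1) <= len (w ^^ (n + m)).
Proof.
  intro H. pose proof (D_pos L).
  pose proof (strong_growth_add L w (2 * D + 1) n m ltac:(lia) H) as K.
  replace (2 * D + 1 - D) with (D + 1) in K by lia. exact K.
Qed.

Lemma axial_linear w n : axial w -> Z.of_nat n <= len (w ^^ n).
Proof.
  intro H. pose proof (axial_growth w 0 n H) as K. cbn [npow Nat.add] in K.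
  rewrite (len_one L) in K. pose proof (D_pos L). nia.
Qed.

(** Sufficiently many distinct powers of [u] have large minimal displacement, so [strong_element]
    applies at the best base point; a product of two such powers is again a power of [u]. *)
Lemma axial_conj_of_infinite_order u : infinite_order u ->
  exists i o, (i > 0)%nat /\ axial (!o ** u ^^ i ** o).
Proof.
  intro Hu. pose proof (D_pos L) as HD.
  destruct (displacement_large L) as [N HN].
  set (F := map (fun i => u ^^ i) (seq 0 (S N))).
  destruct (minimal_displacement L F) as [p [mu [Hmu0 [Hmu Hmin]]]].
  { unfold F. cbn. congruence. }
  assert (Hbig : 100 * D <= mu).
  { apply (HN F mu p); trivial.
    - apply NoDup_map_NoDup_ForallPairs; [|apply seq_NoDup].
      intros i j _ _ E. now apply infinite_order_inj in E.
    - unfold F. rewrite length_map, length_seq. lia. }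
  destruct (strong_element L (map (fun s => !p ** s ** p) F) mu Hbig) as [g [Hg Hs]].
  - intros s Hs. apply in_map_iff in Hs. destruct Hs as [s' [<- Hs']].
    specialize (Hmu s' Hs'). unfold dist in Hmu. now rewrite gmul_assoc in Hmu.
  - intro q. destruct (Hmin (p ** q)) as [s [Hs Hq]].
    exists (!p ** s ** p). split; [now apply (in_map (fun s => !p ** s ** p))|].
    rewrite dist_mul_l in Hq. now rewrite !gmul_assoc_r in *.
  - assert (Hi : exists i, g = !p ** u ^^ i ** p).
    { assert (K : forall s, In s (map (fun s => !p ** s ** p) F) -> exists i, s = !p ** u ^^ i ** p).
      { intros s Hin. apply in_map_iff in Hin. destruct Hin as [s' [<- Hin]].
        apply in_map_iff in Hin. destruct Hin as [i [<- _]]. eauto. }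
      apply in_short_products in Hg. destruct Hg as [Hg|[s [t [Hs' [Ht ->]]]]]; [auto|].
      destruct (K s Hs') as [i ->]. destruct (K t Ht) as [j ->].
      exists (i + j)%nat. rewrite npow_add. grp_eq. }
    destruct Hi as [i ->]. exists i, p. split.
    + destruct i as [|i]; [|lia]. exfalso. cbn in Hs. revert Hs. grp.
      rewrite (len_one L). lia.
    + unfold axial. lia.
Qed.

(** A normalising [x] carries a long segment from w^-N to w^N close to itself, possibly reversed, so
    [x] lies near some point of it. The bound does not involve [x], and balls are finite. *)
Lemma axial_normalizer w : axial w -> exists T : list G, forall x, normalizes_power w x ->
  exists y e, is_power w y /\ In e T /\ x = y ** e.
Proof.
  intro Hw. pose proof (D_pos L) as HD. pose proof (len_nonneg L w) as Hw0.
  set (C := len w + 2 * D).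
  destruct (len_ball L (C + 2 * D + len w)) as [T HT]. exists T. intros x [j [Hj Hx]].
  pose proof (len_nonneg L x) as Hx0.
  (* A multiple of [j], so that [x] still normalises w^N, and so large that moving the ends by
     [len x] is negligible. *)
  set (N := (j * Z.to_nat (2 * len x + C + 3 * D + 1))%nat).
  assert (HN : 2 * len x + C + 3 * D < len (w ^^ N)).
  { pose proof (axial_linear w N Hw) as K. unfold N in *. unfold C in *. nia. }
  assert (Hxn : up_to_sign (x ** w ^^ N ** !x) (w ^^ N)).
  { unfold N. rewrite npow_mul, <- npow_conj. now apply up_to_sign_pow. }
  set (b := w ^^ N) in *. set (a := !b).
  assert (Hends : (d (x ** a) a <= len x /\ d (x ** b) b <= len x) \/
                  (d (x ** a) b <= len x /\ d (x ** b) a <= len x)).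
  { assert (Hr : forall y z, x ** y ** !x = z -> d (x ** y) z <= len x).
    { intros y z <-. rewrite (dist_sym L), <- (len_inv L x). unfold dist.
      apply Z.eq_le_incl. rewrite <- (len_inv L (!x)). f_equal. grp_eq. }
    destruct Hxn as [E|E]; [left|right]; split; apply Hr; trivial.
    - unfold a. transitivity (!(x ** b ** !x)); [grp_eq|]. now rewrite E.
    - unfold a. transitivity (!(x ** b ** !x)); [grp_eq|]. rewrite E. grp_eq. }
  assert (Hla : len a = len b) by apply (len_inv L).
  pose proof (strong_straight L w (2 * D + 1) N N ltac:(lia) Hw) as S0. fold b a in S0. fold C in S0.
  rewrite <- (gprod_mul x), gmul_1r in S0.
  assert (Hab : gp x a b <= C + 2 * D).
  { assert (Hfar : forall y z, len y = len b -> len z = len b -> d (x ** y) z <= len x ->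
      C + 3 * D < gp x (x ** y) z).
    { intros y z Hy Hz Hd. unfold gprod. rewrite dist_mul_r.
      pose proof (dist_tri L gone x z) as T1. rewrite !dist_one in T1. lia. }
    destruct Hends as [[E1 E2]|[E1 E2]].
    - pose proof (Hfar a a Hla Hla E1) as F1. pose proof (Hfar b b eq_refl eq_refl E2) as F2.
      pose proof (gprod_hyp L x (x ** a) (x ** b) a). pose proof (gprod_hyp L x a (x ** b) b).
      rewrite (gprod_sym L x (x ** b) b) in *. lia.
    - pose proof (Hfar a b Hla eq_refl E1) as F1. pose proof (Hfar b a eq_refl Hla E2) as F2.
      pose proof (gprod_hyp L x (x ** a) (x ** b) b). pose proof (gprod_hyp L x b (x ** b) a).
      rewrite (gprod_sym L x (x ** b) a), (gprod_sym L x b a) in *. lia. }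
  (* A discrete intermediate value argument: just before the first power whose product with [a] is
     small, the product with [b] is already small, and one step changes it by at most
     [2 * len w]. *)
  destruct (nat_least (fun i => (i <= N + N)%nat /\ gp x (a ** w ^^ i) a <= C + 3 * D))
    as [i [[HiN Hi] Hmin]].
  { exists (N + N)%nat. split; [lia|]. replace (a ** w ^^ (N + N)) with b.
    - rewrite (gprod_sym L). lia.
    - rewrite npow_add. fold b. unfold a. grp_eq. }
  assert (Hib : gp x (a ** w ^^ i) b <= C + 3 * D + 2 * len w).
  { destruct i as [|i].
    - exfalso. cbn [npow] in Hi. rewrite gmul_1r in Hi. unfold gprod in Hi.
      rewrite (dist_refl L) in Hi.
      pose proof (dist_tri L gone x a) as T1. rewrite !dist_one in T1. lia.
    - assert (K : C + 3 * D < gp x (a ** w ^^ i) a).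
      { apply Z.nle_gt. intro K. assert (Hi' : (i <= N + N)%nat) by lia.
        specialize (Hmin i (conj Hi' K)). lia. }
      pose proof (gprod_hyp L x a b (a ** w ^^ i)) as K2.
      rewrite (gprod_sym L x a) in K2.
      pose proof (gprod_move L x b (a ** w ^^ i) (a ** w ^^ S i)) as K3.
      rewrite !(gprod_sym L x b) in K3.
      replace (d (a ** w ^^ i) (a ** w ^^ S i)) with (len w) in K3; [lia|].
      unfold dist. f_equal. rewrite npow_Sr. grp_eq. }
  pose proof (strong_straight L w (2 * D + 1) i (N + N - i) ltac:(lia) Hw) as S1. fold C in S1.
  rewrite <- (gprod_mul (a ** w ^^ i)), gmul_1r in S1.
  replace (a ** w ^^ i ** !(w ^^ i)) with a in S1 by grp_eq.
  replace (a ** w ^^ i ** w ^^ (N + N - i)) with b in S1.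
  2:{ rewrite gmul_assoc_r, <- npow_add. replace (i + (N + N - i))%nat with (N + N)%nat by lia.
      rewrite npow_add. fold b. unfold a. grp_eq. }
  set (y := a ** w ^^ i) in *.
  assert (Hd : d y x <= C + 2 * D + len w).
  { pose proof (gprod_hyp L y a b x). pose proof (gprod_swap L x y a). pose proof (gprod_swap L x y b).
    rewrite (gprod_sym L y a x) in *. rewrite (dist_sym L y x). lia. }
  exists y, (!y ** x). repeat split.
  - apply is_power_mul; [|now exists i; left]. exists N. now right.
  - now apply HT.
  - grp_eq.
Qed.

(** Two powers of [x] with the same remainder in the finite list of [axial_normalizer] differ by a
    power of [w], nontrivial because [x] has infinite order. *)
Lemma normalizer_power w x : axial w -> infinite_order x -> normalizes_power w x ->
  exists m n, (m > 0)%nat /\ (n > 0)%nat /\ up_to_sign (x ^^ m) (w ^^ n).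
Proof.
  intros Hw Hx Hn. destruct (axial_normalizer w Hw) as [T HT].
  assert (K : forall n, exists e, In e T /\ is_power w (x ^^ n ** !e)).
  { intro n. destruct (HT (x ^^ n)) as [y [e [Hy [He E]]]]; [now apply normalizes_power_pow|].
    exists e. split; trivial. rewrite E. revert Hy. grp. trivial. }
  apply choose_function in K. destruct K as [f Hf].
  destruct (pigeonhole f T) as [i [j [Hij E]]]; [intros i _; apply Hf|].
  destruct (Hf i) as [_ Hi]. destruct (Hf j) as [_ Hj]. rewrite <- E in Hj.
  pose proof (is_power_mul w _ _ Hj (is_power_inv w _ Hi)) as [k Hk].
  replace (x ^^ j ** !(f i) ** !(x ^^ i ** !(f i))) with (x ^^ (j - i)) in Hk
    by (rewrite npow_sub by lia; grp_eq).
  exists (j - i)%nat, k. split; [lia|]. split; [|exact Hk].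
  destruct k as [|k]; [|lia]. exfalso. apply (Hx (j - i)%nat); [lia|].
  destruct Hk as [Hk|Hk]; rewrite Hk; cbn; [reflexivity|grp_eq].
Qed.

(** Conjugation by [t] changes lengths by at most [2 * len t], whereas for distinct exponents the
    [k]-th powers of both sides differ in length by more. *)
Lemma axial_same_exponent w t m n : axial w ->
  up_to_sign (t ** w ^^ m ** !t) (w ^^ n) -> m = n.
Proof.
  intros Hw H.
  set (k := Z.to_nat (2 * len t + 1)).
  assert (Hk : up_to_sign (t ** w ^^ (m * k) ** !t) (w ^^ (n * k))).
  { rewrite !npow_mul, <- npow_conj. now apply up_to_sign_pow. }
  assert (E : len (t ** w ^^ (m * k) ** !t) = len (w ^^ (n * k))).
  { destruct Hk as [Hk|Hk]; rewrite Hk; [reflexivity|apply (len_inv L)]. }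
  pose proof (len_mul L (t ** w ^^ (m * k)) (!t)) as A1. pose proof (len_mul L t (w ^^ (m * k))) as A2.
  pose proof (len_mul L (!t ** (t ** w ^^ (m * k) ** !t)) t) as A3.
  pose proof (len_mul L (!t) (t ** w ^^ (m * k) ** !t)) as A4.
  replace (!t ** (t ** w ^^ (m * k) ** !t) ** t) with (w ^^ (m * k)) in A3 by grp_eq.
  rewrite (len_inv L) in A1, A4. pose proof (len_nonneg L t). pose proof (D_pos L).
  destruct (Nat.lt_trichotomy m n) as [Hlt|[Heq|Hlt]]; trivial; exfalso.
  - pose proof (axial_growth w (m * k) ((n - m) * k) Hw) as K.
    replace (m * k + (n - m) * k)%nat with (n * k)%nat in K by nia.
    assert (Z.of_nat k <= Z.of_nat ((n - m) * k) * (D + 1)) by nia. lia.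
  - pose proof (axial_growth w (n * k) ((m - n) * k) Hw) as K.
    replace (n * k + (m - n) * k)%nat with (m * k)%nat in K by nia.
    assert (Z.of_nat k <= Z.of_nat ((m - n) * k) * (D + 1)) by nia. lia.
Qed.

Lemma conj_relation_normalizes u t m n : infinite_order u -> (m > 0)%nat ->
  up_to_sign (t ** u ^^ m ** !t) (u ^^ n) ->
  forall i o, axial (!o ** u ^^ i ** o) -> normalizes_power (!o ** u ^^ i ** o) (!o ** t ** o).
Proof.
  intros Hu Hm H i o Hw. set (w := !o ** u ^^ i ** o) in *. exists m. split; trivial.
  assert (K : up_to_sign (!o ** t ** o ** w ^^ m ** !(!o ** t ** o)) (w ^^ n)).
  { apply (up_to_sign_pow _ _ i) in H. apply (up_to_sign_conj (!o)) in H.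
    unfold w. rewrite !npow_conj_inv.
    rewrite npow_conj in H. rewrite <- !npow_mul in *.
    replace (!o ** t ** o ** (!o ** u ^^ (i * m) ** o) ** !(!o ** t ** o))
      with (!o ** (t ** u ^^ (m * i) ** !t) ** !!o) by (rewrite (Nat.mul_comm m i); grp_eq).
    replace (!o ** u ^^ (i * n) ** o) with (!o ** u ^^ (n * i) ** !!o)
      by (rewrite (Nat.mul_comm n i); grp_eq). exact H. }
  pose proof (axial_same_exponent w (!o ** t ** o) m n Hw K). now subst n.
Qed.

Lemma conj_relation_commensurable u v m n : infinite_order u -> infinite_order v -> (m > 0)%nat ->
  up_to_sign (v ** u ^^ m ** !v) (u ^^ n) -> commensurable v u.
Proof.
  intros Hu Hv Hm H. destruct (axial_conj_of_infinite_order u Hu) as [i [o [Hi Hw]]].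
  pose proof (conj_relation_normalizes u v m n Hu Hm H i o Hw) as Hn.
  apply normalizer_power in Hn; trivial.
  - destruct Hn as [a [b [Ha [Hb E]]]]. exists a, (i * b)%nat. repeat split; [lia|nia|].
    rewrite !npow_conj_inv in E. apply (up_to_sign_conj o) in E.
    rewrite npow_mul. revert E. grp. trivial.
  - rewrite <- (ginv_inv o) at 2. now apply infinite_order_conj.
Qed.

(** A power of [u] commuting with the commutator also commutes with a = v u v^-1. Then [a] and [u]
    have a common power up to sign, which is a relation v u^m v^-1 = u^n up to sign and makes [v]
    commensurable with [u]. *)
Lemma commutator_commensurable u v : infinite_order u -> infinite_order v ->
  ~ comm_independent u v -> commensurable v u.
Proof.
  intros Hu Hv H. apply not_all_ex_not in H. destruct H as [j H].
  apply imply_to_and in H. destruct H as [Hj H]. apply NNPP in H.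
  set (a := v ** u ** !v).
  assert (Ha : u ^^ j ** a = a ** u ^^ j).
  { replace a with (!(!u ** commutator u v)) by (unfold commutator, a; grp_eq).
    apply comm_inv_r, comm_mul; trivial.
    apply comm_inv_r. symmetry. now apply npow_comm. }
  destruct (axial_conj_of_infinite_order u Hu) as [i [o [Hi Hw]]].
  set (w := !o ** u ^^ i ** o) in *.
  assert (Hn : normalizes_power w (!o ** a ** o)).
  { exists j. split; trivial. left. unfold w. rewrite !npow_conj_inv, <- npow_mul.
    assert (E : a ** u ^^ (i * j) = u ^^ (i * j) ** a).
    { rewrite Nat.mul_comm, npow_mul. now apply npow_comm. }
    transitivity (!o ** (a ** u ^^ (i * j)) ** !a ** o); [grp_eq|]. rewrite E. grp_eq. }
  apply normalizer_power in Hn; trivial.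
  - destruct Hn as [m [n [Hm [Hn E]]]].
    apply (conj_relation_commensurable u v m (i * n)); trivial.
    rewrite npow_conj_inv in E. unfold w in E. rewrite npow_conj_inv in E.
    apply (up_to_sign_conj o) in E. rewrite npow_mul.
    unfold a in E. rewrite npow_conj in E. revert E. grp. trivial.
  - rewrite <- (ginv_inv o) at 2. now apply infinite_order_conj, infinite_order_conj.
Qed.

(** Otherwise every element conjugates some power of [u] to a power of [u] up to sign, the whole
    group normalises powers of one axial element, and [axial_normalizer] makes it virtually
    cyclic. *)
Lemma exists_not_commensurable u v : ~ virtually_cyclic G ->
  infinite_order u -> infinite_order v -> exists t, ~ commensurable u (t ** v ** !t).
Proof.
  intros HG Hu Hv. apply NNPP. intro N.
  assert (Hall : forall t, commensurable u (t ** v ** !t)).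
  { intro t. apply NNPP. intro K. apply N. now exists t. }
  clear N. apply HG.
  destruct (axial_conj_of_infinite_order u Hu) as [i [o [Hi Hw]]].
  set (w := !o ** u ^^ i ** o) in *.
  assert (Hnorm : forall x, normalizes_power w x).
  { intro x. set (t := o ** x ** !o).
    replace x with (!o ** t ** o) by (unfold t; grp_eq).
    destruct (Hall gone) as [a [b [Ha [Hb E1]]]].
    destruct (Hall t) as [a' [b' [Ha' [Hb' E2]]]].
    replace (gone ** v ** !gone) with v in E1 by grp_eq.
    apply (conj_relation_normalizes u t (a * b') (a' * b)); trivial; [nia|].
    apply (up_to_sign_pow _ _ b') in E1. apply (up_to_sign_pow _ _ b) in E2.
    rewrite npow_conj, npow_conj in E2. rewrite <- !npow_mul in *.
    apply (up_to_sign_conj t) in E1.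
    apply up_to_sign_trans with (t ** v ^^ (b * b') ** !t); trivial.
    rewrite (Nat.mul_comm b b'). now apply up_to_sign_sym. }
  destruct (axial_normalizer w Hw) as [T HT].
  (* [axial_normalizer] puts the power of [w] on the left, [virtually_cyclic] on the right; hence
     the inverses. *)
  exists w, (map ginv T). intro g.
  destruct (HT (!g) (Hnorm (!g))) as [y [e [Hy [He E]]]].
  destruct (is_power_zpow w (!y) (is_power_inv w y Hy)) as [z Hz].
  exists (!e), z. split; [now apply in_map|].
  rewrite <- Hz, <- ginv_mul, <- E. grp_eq.
Qed.

Lemma not_commensurable_independent u v : infinite_order u -> infinite_order v ->
  ~ commensurable u v -> comm_independent u v /\ comm_independent v u.
Proof.
  intros Hu Hv H. split; apply NNPP; intro K; apply H.
  - apply commensurable_sym. now apply commutator_commensurable.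
  - now apply commutator_commensurable.
Qed.

Lemma not_commensurable_conj_independent u v n : infinite_order u -> infinite_order v ->
  (n > 0)%nat -> ~ commensurable u v -> comm_independent u (v ^^ n ** u ** !(v ^^ n)).
Proof.
  intros Hu Hv Hn H. apply NNPP. intro K. apply H.
  apply commutator_commensurable in K; trivial; [|now apply infinite_order_conj].
  destruct K as [a [b [Ha [Hb E]]]]. rewrite npow_conj in E.
  apply conj_relation_commensurable in E; trivial; [|now apply infinite_order_pow].
  destruct E as [c [e [Hc [He E]]]]. rewrite <- npow_mul in E.
  apply commensurable_sym. exists (n * c)%nat, e. repeat split; trivial. nia.
Qed.

End AxialElements.

(** * An element that translates for every normalised automorphism *)

Lemma comm_independent_hom {G : Group} (psi : G -> G) (u v : G) : hom_inj psi ->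
  comm_independent u v -> comm_independent (psi u) (psi v).
Proof.
  intros [H I] Huv j Hj E. apply (Huv j Hj), I. unfold commutator in *.
  now rewrite !H, (hom_inv psi u H), (hom_inv psi v H), (hom_pow psi u j H).
Qed.

Lemma infinite_order_hom {G : Group} (psi : G -> G) (u : G) : is_endomorphism G psi ->
  infinite_order (psi u) -> infinite_order u.
Proof.
  intros H Hu n Hn E. apply (Hu n Hn). now rewrite <- hom_pow, E, hom_one.
Qed.

Section UniversalElement.
Context {G : Group} {len : G -> Z} {D : Z} (L : hyp_length G len D).
Context (F : list G).
Context (Hgen : forall g, exists n, 0 <= n /\ forall psi, is_endomorphism G psi ->
  forall q A, (forall s, In s F -> dist len q (psi s ** q) <= A) ->
  dist len q (psi g ** q) <= n * A).
Context (Hlarge : forall psi p mu, hom_inj psi ->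
  (forall s, In s F -> dist len p (psi s ** p) <= mu) -> 100 * D <= mu).
Context (HG : ~ virtually_cyclic G).
Implicit Types x y z w p q g h s t u v : G.
Implicit Types psi : G -> G.
Local Notation d := (dist len).
Local Notation gp := (gprod len).

Definition controlled psi (mu : Z) : Prop :=
  hom_inj psi /\ 100 * D <= mu /\ forall s, In s F -> len (psi s) <= mu.

(* The base point 1 minimises the displacement of [psi F], with value [mu]. *)
Definition minimal psi (mu : Z) : Prop :=
  controlled psi mu /\ forall q, exists s, In s F /\ mu <= d q (psi s ** q).

(** Linear growth at rate mu / N up to an additive error, cleared of denominators. The constants are
    to be shared by all [psi]. *)
Definition grows (N C : Z) psi (mu : Z) (g : G) : Prop :=
  forall n, Z.of_nat n * mu <= N * len (psi g ^^ n) + C * mu.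

Lemma len_bound g : exists n, 0 <= n /\ forall psi mu, controlled psi mu -> len (psi g) <= n * mu.
Proof.
  destruct (Hgen g) as [n [Hn H]]. exists n. split; trivial.
  intros psi mu [[Hpsi _] [_ Hs]]. specialize (H psi Hpsi gone mu).
  rewrite gmul_1r, dist_one in H. apply H. intros s Hin. rewrite gmul_1r, dist_one. auto.
Qed.

Lemma exists_minimal psi : hom_inj psi -> exists p mu, minimal (conj_by (!p) psi) mu.
Proof.
  intro Hpsi. destruct (minimal_displacement L (map psi F)) as [p [mu [Hmu0 [Hmu Hmin]]]].
  { intro E. apply map_eq_nil in E. assert (K : 100 * D <= 0).
    { apply (Hlarge psi gone); trivial. rewrite E. now intros s []. }
    pose proof (D_pos L). lia. }
  assert (Hd : forall s q, d q (conj_by (!p) psi s ** q) = d (p ** q) (psi s ** (p ** q))).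
  { intros s q. unfold conj_by. rewrite <- (dist_mul p). f_equal. grp_eq. }
  exists p, mu. split; [split; [now apply conj_hom_inj|split]|].
  - apply (Hlarge psi p); trivial. intros s Hs. apply Hmu. now apply in_map.
  - intros s Hs. specialize (Hmu (psi s) (in_map psi F s Hs)).
    specialize (Hd s gone). rewrite !gmul_1r, dist_one in Hd. lia.
  - intro q. destruct (Hmin (p ** q)) as [s [Hs Hq]]. apply in_map_iff in Hs.
    destruct Hs as [s' [<- Hs']]. exists s'. split; trivial. now rewrite Hd.
Qed.

Lemma minimal_strong psi mu : minimal psi mu ->
  exists g, In g (short_products F) /\ 8 * len (psi g) + mu <= 8 * len (psi g ^^ 2).
Proof.
  intros [[[Hpsi Hinj] [Hmu Hs]] Hmin].
  destruct (strong_element L (map psi F) mu Hmu) as [g [Hg H]].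
  - intros s Hin. apply in_map_iff in Hin. destruct Hin as [s' [<- Hs']]. auto.
  - intro q. destruct (Hmin q) as [s [Hin Hq]]. exists (psi s). split; trivial. now apply in_map.
  - apply in_short_products in Hg. destruct Hg as [Hg|[s [t [Hs1 [Ht ->]]]]].
    + apply in_map_iff in Hg. destruct Hg as [g' [<- Hg']]. exists g'. split; trivial.
      apply in_short_products. now left.
    + apply in_map_iff in Hs1. destruct Hs1 as [s' [<- Hs1]].
      apply in_map_iff in Ht. destruct Ht as [t' [<- Ht]].
      exists (s' ** t'). split; [apply in_short_products; eauto 6|]. now rewrite Hpsi.
Qed.

(** Each power gains [k - D] with [k] about mu / 8 and [D] at most mu / 100, hence at least mu /
    16. *)
Lemma strong_grows psi mu g : 100 * D <= mu ->
  8 * len (psi g) + mu <= 8 * len (psi g ^^ 2) -> grows 16 0 psi mu g.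
Proof.
  intros Hmu H n. pose proof (D_pos L). destruct (floor_div mu 8 ltac:(lia)) as [k Hk].
  pose proof (strong_growth_linear L (psi g) k n ltac:(lia) ltac:(lia)).
  assert (mu <= 16 * (k - D)) by lia. nia.
Qed.

Lemma grows_mono N C N' C' psi mu g : 0 <= mu -> N <= N' -> C <= C' ->
  grows N C psi mu g -> grows N' C' psi mu g.
Proof.
  intros Hmu HN HC H n. specialize (H n). pose proof (len_nonneg L (psi g ^^ n)). nia.
Qed.

Lemma grows_conj N C t : 0 <= N -> exists C', forall psi mu g, controlled psi mu ->
  grows N C psi mu g -> grows N C' psi mu (t ** g ** !t).
Proof.
  intro HN. destruct (len_bound t) as [n [Hn Ht]]. exists (C + N * (2 * n)).
  intros psi mu g Hc H m. specialize (Ht psi mu Hc). specialize (H m).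
  destruct Hc as [[Hpsi _] _].
  assert (E : psi g ^^ m = !(psi t) ** psi (t ** g ** !t) ^^ m ** psi t).
  { rewrite !Hpsi, hom_inv, npow_conj by trivial. grp_eq. }
  pose proof (len_mul L (!(psi t) ** psi (t ** g ** !t) ^^ m) (psi t)) as A1.
  pose proof (len_mul L (!(psi t)) (psi (t ** g ** !t) ^^ m)) as A2.
  rewrite (len_inv L) in A2. rewrite <- E in A1.
  assert (N * len (psi g ^^ m) <= N * (len (psi (t ** g ** !t) ^^ m) + 2 * (n * mu)))
    by (apply Z.mul_le_mono_nonneg_l; lia).
  lia.
Qed.

Lemma grows_infinite_order N C psi mu g : is_endomorphism G psi -> 0 < mu ->
  grows N C psi mu g -> infinite_order g.
Proof.
  intros Hpsi Hmu H n Hn E. specialize (H (n * Z.to_nat (C + 1))%nat).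
  rewrite npow_mul, <- (hom_pow psi g n Hpsi), E, hom_one, npow_one, (len_one L) in H by trivial.
  nia.
Qed.

(** A conjugate of a power of [g] is axial; the conjugator and the remainder of the exponent go into
    [C]. This untwisted growth keeps [h] of infinite order in [universal_for_list]. *)
Lemma infinite_order_grows mu g : 0 <= mu -> infinite_order g ->
  exists N C, 0 <= N /\ 0 <= C /\ grows N C (fun x => x) mu g.
Proof.
  intros Hmu Hg. destruct (axial_conj_of_infinite_order L g Hg) as [i [o [Hi Hw]]].
  pose proof (len_nonneg L o) as Ho. pose proof (len_nonneg L g) as Hg0.
  set (I := Z.of_nat i). set (c := 2 * len o + I * len g + 1).
  assert (Hc : 0 <= c) by (unfold c, I; nia).
  exists (I * mu), (I * c). repeat split; [unfold I; nia|unfold I; nia|].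
  intro m. pose proof (Nat.div_mod m i ltac:(lia)) as Em.
  pose proof (Nat.mod_upper_bound m i ltac:(lia)) as Er.
  set (n := (m / i)%nat) in *. set (r := (m mod i)%nat) in *.
  pose proof (axial_linear L _ n Hw) as A. rewrite npow_conj_inv, <- npow_mul in A.
  pose proof (len_mul L (!o ** g ^^ (i * n)) o) as A1. pose proof (len_mul L (!o) (g ^^ (i * n))) as A2.
  pose proof (len_mul L (g ^^ m) (!(g ^^ r))) as A3. rewrite (len_inv L) in A2, A3.
  replace (g ^^ m ** !(g ^^ r)) with (g ^^ (i * n)) in A3 by (rewrite Em, npow_add; grp_eq).
  pose proof (displacement_pow L gone g r (len g)) as A4.
  rewrite !gmul_1r, !dist_one in A4. specialize (A4 ltac:(lia)).
  assert (A5 : Z.of_nat r * len g <= I * len g) by (apply Z.mul_le_mono_nonneg_r; unfold I; lia).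
  assert (A6 : Z.of_nat n + 1 <= len (g ^^ m) + c) by (unfold c; lia).
  assert (A7 : Z.of_nat m <= I * (Z.of_nat n + 1)) by (unfold I; nia).
  assert (A8 : I * (Z.of_nat n + 1) <= I * (len (g ^^ m) + c))
    by (apply Z.mul_le_mono_nonneg_l; unfold I; lia).
  assert (Z.of_nat m * mu <= I * (len (g ^^ m) + c) * mu)
    by (apply Z.mul_le_mono_nonneg_r; lia).
  lia.
Qed.

(* When [psi v ^^ M] is short it is merged into the neighbouring long segments, which are then
   governed by the pair [u], [v^M u v^-M]. *)
Lemma product_grows u v N C : infinite_order u -> infinite_order v -> ~ commensurable u v ->
  0 <= N -> 0 <= C ->
  exists M0, forall M, (M0 <= M)%nat -> forall psi mu, controlled psi mu ->
  grows N C psi mu u -> grows 2 0 psi mu (u ^^ M ** v ^^ M).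
Proof.
  intros Hu Hv Huv HN HC. pose proof (D_pos L) as HD.
  destruct (overlap_bound L) as [Mo [HMo Hov]].
  destruct (len_bound u) as [nu [Hnu Hlu]]. destruct (len_bound v) as [nv [Hnv Hlv]].
  set (R := nu + nv + 1). set (M1 := Mo * R). set (R2 := R + 2 * (M1 + 1)). set (M2 := Mo * R2).
  assert (HM1 : 0 <= M1) by (unfold M1, R; nia).
  assert (HM2 : 0 <= M2) by (unfold M2, R2, R; nia).
  (* In the case of a short [W], five copies of it are discarded, each below [(M1 + 1) * mu]; [M2]
     pays for the overlap and 1 is the required gain. *)
  set (E := 5 * (M1 + 1) + M2 + 1).
  exists (S (Z.to_nat (C + N * E))). intros M HM psi mu Hc Hg.
  specialize (Hlu psi mu Hc). specialize (Hlv psi mu Hc).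
  destruct Hc as [Hpsi [Hmu _]].
  assert (Hmu0 : 0 < mu) by lia.
  set (U := psi u ^^ M). set (W := psi v ^^ M).
  assert (Hab : E * mu <= len U).
  { specialize (Hg M). fold U in Hg.
    assert ((C + N * E) * mu < Z.of_nat M * mu) by (apply Z.mul_lt_mono_pos_r; lia).
    assert (N * (E * mu) < N * len U) by lia. nia. }
  assert (HM1mu : 0 <= M1 * mu) by nia. assert (HM2mu : 0 <= M2 * mu) by nia.
  unfold E in Hab.
  destruct (not_commensurable_independent L u v Hu Hv Huv) as [Hind _].
  pose proof (comm_independent_hom psi u v Hpsi Hind) as Hind'.
  assert (HUc : psi u ** U = U ** psi u) by apply npow_comm_self.
  assert (HWc : psi v ** W = W ** psi v) by apply npow_comm_self.
  assert (HRmu : D <= R * mu) by (unfold R; nia).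
  assert (HuR : len (psi u) <= R * mu) by (unfold R; nia).
  assert (HvR : len (psi v) <= R * mu) by (unfold R; nia).
  assert (G1 : gp gone (!U) W <= M1 * mu).
  { unfold M1. rewrite <- Z.mul_assoc. apply (Hov (psi u) (psi v)); trivial. now apply comm_inv_r. }
  assert (G2 : gp gone U (!W) <= M1 * mu).
  { unfold M1. rewrite <- Z.mul_assoc. apply (Hov (psi u) (psi v)); trivial. now apply comm_inv_r. }
  assert (Hh : psi (u ^^ M ** v ^^ M) = U ** W).
  { destruct Hpsi as [Hpsi _]. now rewrite Hpsi, (hom_pow psi u M Hpsi), (hom_pow psi v M Hpsi). }
  assert (Hstrong : len (U ** W) + mu <= len ((U ** W) ^^ 2)).
  { destruct (Z.le_gt_cases ((M1 + 1) * mu) (len W)) as [HW|HW].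
    - pose proof (product_strong L U W mu ltac:(lia)) as P.
      rewrite (gprod_sym L gone (!W) U) in P. lia.
    - set (u' := W ** psi u ** !W).
      assert (Hu' : len u' <= R2 * mu).
      { pose proof (len_mul L (W ** psi u) (!W)) as T1. pose proof (len_mul L W (psi u)) as T2.
        rewrite (len_inv L) in T1. unfold u', R2. lia. }
      assert (G3 : gp gone (!U) (W ** U ** !W) <= M2 * mu).
      { unfold M2. rewrite <- Z.mul_assoc.
        apply (Hov (psi u) u'); trivial; try (unfold R2; lia).
        - now apply comm_inv_r.
        - unfold u', U. rewrite <- npow_conj. apply npow_comm_self.
        - pose proof (not_commensurable_conj_independent L u v M Hu Hv ltac:(lia) Huv) as K.
          apply (comm_independent_hom psi _ _ Hpsi) in K. destruct Hpsi as [Hpsi _].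
          rewrite !Hpsi, (hom_inv psi _ Hpsi), (hom_pow psi v M Hpsi) in K. exact K. }
      unfold gprod in G3. rewrite !dist_one, (len_inv L) in G3.
      replace (d (!U) (W ** U ** !W)) with (len (U ** W ** U ** !W)) in G3
        by (unfold dist; f_equal; grp_eq).
      pose proof (len_mul L ((U ** W) ^^ 2) (!W ** !W)) as T1. pose proof (len_mul L (!W) (!W)) as T2.
      replace ((U ** W) ^^ 2 ** (!W ** !W)) with (U ** W ** U ** !W) in T1 by (cbn; grp_eq).
      pose proof (len_mul L (!W ** (W ** U ** !W)) W) as T3.
      replace (!W ** (W ** U ** !W) ** W) with U in T3 by grp_eq.
      pose proof (len_mul L (!W) (W ** U ** !W)) as T4. pose proof (len_mul L U W) as T5.
      rewrite !(len_inv L) in *. lia. }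
  intro n. rewrite Hh. pose proof (strong_growth_linear L (U ** W) mu n ltac:(lia) Hstrong). nia.
Qed.

(** One large [M] serves both orders of the pair, and u^M conjugates v^M u^M to u^M v^M, so growth
    of either factor suffices. *)
Lemma combine_growth u v N C : infinite_order u -> infinite_order v -> ~ commensurable u v ->
  0 <= N -> 0 <= C ->
  exists h N' C', 0 <= N' /\ 0 <= C' /\ forall psi mu, controlled psi mu ->
  grows N C psi mu u \/ grows N C psi mu v -> grows N' C' psi mu h.
Proof.
  intros Hu Hv Huv HN HC. pose proof (D_pos L) as HD.
  destruct (product_grows u v N C) as [Ma HMa]; trivial.
  destruct (product_grows v u N C) as [Mb HMb]; trivial.
  { intro K. now apply Huv, commensurable_sym. }
  set (M := (Ma + Mb)%nat). specialize (HMa M ltac:(lia)). specialize (HMb M ltac:(lia)).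
  destruct (grows_conj 2 0 (u ^^ M) ltac:(lia)) as [C' HC'].
  exists (u ^^ M ** v ^^ M), 2, (Z.max 0 C'). repeat split; [lia|lia|].
  intros psi mu Hc Hg. assert (Hmu : 0 <= mu) by (destruct Hc as [_ [? _]]; lia).
  destruct Hg as [Hg|Hg].
  - specialize (HMa psi mu Hc Hg). revert HMa. apply grows_mono; lia.
  - specialize (HMb psi mu Hc Hg). apply HC' in HMb; trivial.
    replace (u ^^ M ** v ^^ M) with (u ^^ M ** (v ^^ M ** u ^^ M) ** !(u ^^ M)) by grp_eq.
    revert HMb. apply grows_mono; lia.
Qed.

Lemma exists_infinite_order : exists g : G, infinite_order g.
Proof.
  assert (Hid : @hom_inj G (fun x => x)) by (split; [now intros x y|trivial]).
  destruct (exists_minimal _ Hid) as [p [mu Hmin]].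
  destruct (minimal_strong _ _ Hmin) as [g [_ Hg]].
  destruct Hmin as [[[Hpsi _] [Hmu _]] _]. pose proof (D_pos L).
  pose proof (strong_grows _ mu g Hmu Hg) as K.
  exists g. revert K. apply grows_infinite_order; trivial. lia.
Qed.

Lemma controlled_id : exists mu, controlled (fun x => x) mu.
Proof.
  assert (H : exists mu, 100 * D <= mu /\ forall s, In s F -> len s <= mu).
  { clear Hgen Hlarge. induction F as [|s l [mu [Hmu H]]].
    - exists (100 * D). split; [lia|]. now intros s [].
    - exists (Z.max mu (len s)). split; [lia|]. intros t [<-|Ht]; [lia|].
      specialize (H t Ht). lia. }
  destruct H as [mu [Hmu H]]. exists mu. split; [split; [now intros x y|trivial]|auto].
Qed.

(** The elements of the list are merged into [h] one at a time. One of finite order can never be the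
    translating element; one of infinite order is first conjugated so as not to be commensurable
    with [h]. *)
Lemma universal_for_list (l : list G) : exists h N C, infinite_order h /\ 0 <= N /\ 0 <= C /\
  forall psi mu, controlled psi mu ->
  (exists g, In g l /\ 8 * len (psi g) + mu <= 8 * len (psi g ^^ 2)) -> grows N C psi mu h.
Proof.
  pose proof (D_pos L) as HD.
  induction l as [|g l [h [N [C [Hh [HN [HC IH]]]]]]].
  - destruct exists_infinite_order as [h Hh]. exists h, 0, 0.
    repeat split; trivial; try lia. now intros psi mu _ [g [[] _]].
  - destruct (classic (infinite_order g)) as [Hg|Hg].
    + destruct (exists_not_commensurable L h g HG Hh Hg) as [t Ht].
      destruct controlled_id as [mu0 Hmu0].
      assert (Hmu0' : 0 < mu0) by (destruct Hmu0 as [_ [? _]]; lia).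
      destruct (infinite_order_grows mu0 h ltac:(lia) Hh) as [N0 [C0 [HN0 [HC0 Hg0]]]].
      destruct (grows_conj 16 0 t ltac:(lia)) as [C1 HC1].
      set (N2 := Z.max N0 (Z.max N 16)). set (C2 := Z.max C0 (Z.max C C1)).
      destruct (combine_growth h (t ** g ** !t) N2 C2) as [h' [N' [C' [HN' [HC' K]]]]]; trivial;
        [now apply infinite_order_conj|lia|lia|].
      exists h', N', C'. split; [|split; [trivial|split; [trivial|]]].
      (* Infinite order of the new element is read off its growth for the identity, where the old
         [h] grows. *)
      * apply (grows_infinite_order N' C' (fun x => x) mu0); [now intros x y|trivial|].
        apply K; trivial. left. revert Hg0. apply grows_mono; lia.
      * intros psi mu Hc [g' [Hin Hs]].
        assert (Hmu : 100 * D <= mu) by (destruct Hc as [_ [? _]]; lia).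
        apply K; trivial. destruct Hin as [<-|Hin].
        -- right. apply strong_grows in Hs; trivial. apply HC1 in Hs; trivial.
           revert Hs. apply grows_mono; lia.
        -- left. assert (K2 : grows N C psi mu h) by eauto. revert K2. apply grows_mono; lia.
    + exists h, N, C. repeat split; trivial. intros psi mu Hc [g' [[<-|Hin] Hs]]; [|eauto].
      exfalso. apply Hg. destruct Hc as [[Hpsi _] [Hmu _]].
      apply strong_grows in Hs; trivial. revert Hs. apply grows_infinite_order; trivial. lia.
Qed.

Lemma universal_element : exists h N C, infinite_order h /\ 0 <= N /\ 0 <= C /\
  forall psi mu, minimal psi mu -> grows N C psi mu h.
Proof.
  destruct (universal_for_list (short_products F)) as [h [N [C [Hh [HN [HC H]]]]]].
  exists h, N, C. repeat split; trivial. intros psi mu Hm. apply H; [apply Hm|].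
  now apply minimal_strong.
Qed.

End UniversalElement.

(** * Twisted conjugacy *)

Section TwistedConjugacy.
Context {G : Group} {len : G -> Z} {D : Z} (L : hyp_length G len D).
Context (F : list G).
Context (Hgen : forall g, exists n, 0 <= n /\ forall psi, is_endomorphism G psi ->
  forall q A, (forall s, In s F -> dist len q (psi s ** q) <= A) ->
  dist len q (psi g ** q) <= n * A).
Context (Hlarge : forall psi p mu, hom_inj psi ->
  (forall s, In s F -> dist len p (psi s ** p) <= mu) -> 100 * D <= mu).
Context (Hlip : forall th, is_endomorphism G th ->
  exists K, 1 <= K /\ forall x, len (th x) <= K * len x).
Context (HG : ~ virtually_cyclic G).
Implicit Types x y z w p q g h s t u v b e : G.
Implicit Types psi : G -> G.
Local Notation d := (dist len).
Local Notation gp := (gprod len).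
Local Notation minimal := (@minimal G len D F).
Local Notation controlled := (@controlled G len D F).

(** Fix two independent elements of [G]. Their images under [psi] stay independent and move both [p]
    and [q] by a bounded multiple of [A], so [acylindrical] bounds the distance. *)
Lemma base_point_unique : exists C, 0 <= C /\ forall psi p q A, hom_inj psi -> D <= A ->
  (forall s, In s F -> d p (psi s ** p) <= A) -> (forall s, In s F -> d q (psi s ** q) <= A) ->
  d p q <= C * A.
Proof.
  destruct (exists_infinite_order L F Hlarge) as [h Hh].
  destruct (exists_not_commensurable L h h HG Hh Hh) as [t Ht].
  set (k := t ** h ** !t) in *.
  assert (Hk : infinite_order k) by now apply infinite_order_conj.
  destruct (not_commensurable_independent L h k Hh Hk Ht) as [Hind _].
  destruct (acylindrical L) as [B [HB HAc]].
  destruct (Hgen h) as [n [Hn Hbh]]. destruct (Hgen k) as [m [Hm Hbk]].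
  exists (B * (n + m + 1)). split; [nia|]. intros psi p q A Hpsi HA Hp Hq.
  pose proof (D_pos L) as HD.
  destruct (Z.le_gt_cases (d p q) (B * (n + m + 1) * A)) as [|Hfar]; trivial. exfalso.
  pose proof (Hbh psi (proj1 Hpsi)) as Hbh'. pose proof (Hbk psi (proj1 Hpsi)) as Hbk'.
  pose proof (Hbh' p A Hp). pose proof (Hbh' q A Hq).
  pose proof (Hbk' p A Hp). pose proof (Hbk' q A Hq).
  assert (HnA : 0 <= n * A) by nia. assert (HmA : 0 <= m * A) by nia.
  apply (HAc (psi h) (psi k) p q ((n + m + 1) * A)); try lia.
  now apply comm_independent_hom.
Qed.

Lemma len_bound_list (l : list G) : exists n, 0 <= n /\ forall psi mu, controlled psi mu ->
  forall g, In g l -> len (psi g) <= n * mu.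
Proof.
  pose proof (D_pos L) as HD.
  induction l as [|g l [n [Hn H]]].
  - exists 0. split; [lia|]. now intros psi mu _ g [].
  - destruct (len_bound (D := D) F Hgen g) as [m [Hm Hg]].
    exists (n + m). split; [lia|]. intros psi mu Hc g' Hin.
    assert (0 <= n * mu /\ 0 <= m * mu) by (destruct Hc as [_ [? _]]; nia).
    destruct Hin as [<-|Hin]; [specialize (Hg psi mu Hc)|specialize (H psi mu Hc g' Hin)]; lia.
Qed.

(** Up to the base point, the metric of psi th is then that of th psi, which [th] compares with the
    metric of psi with constants independent of psi. *)
Definition commutes_mod_inner (th psi : G -> G) : Prop :=
  exists g, forall y, psi (th y) = g ** th (psi y) ** !g.

Definition mutually_inverse (th th' : G -> G) : Prop :=
  (forall x, th (th' x) = x) /\ (forall x, th' (th x) = x).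

Lemma inverse_hom_inj (th th' : G -> G) : is_endomorphism G th ->
  mutually_inverse th th' -> hom_inj th /\ hom_inj th'.
Proof.
  intros Hth [H1 H2].
  assert (I : forall x y, th x = th y -> x = y).
  { intros x y E. now rewrite <- (H2 x), <- (H2 y), E. }
  split; split; trivial.
  - intros x y. apply I. now rewrite H1, Hth, !H1.
  - intros x y E. now rewrite <- (H1 x), <- (H1 y), E.
Qed.

Lemma len_conj_close e x : Z.abs (len (e ** x ** !e) - len x) <= 2 * len e.
Proof.
  pose proof (len_mul L (e ** x) (!e)) as A1. pose proof (len_mul L e x) as A2.
  pose proof (len_mul L (!e ** (e ** x ** !e)) e) as A3. pose proof (len_mul L (!e) (e ** x ** !e)) as A4.
  replace (!e ** (e ** x ** !e) ** e) with x in A3 by grp_eq.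
  rewrite (len_inv L) in *. lia.
Qed.

Lemma dist_move_r x y e : Z.abs (d (x ** e) (y ** e) - d x y) <= 2 * len e.
Proof.
  pose proof (len_conj_close (!e) (!x ** y)) as H. rewrite ginv_inv, (len_inv L) in H.
  unfold dist. replace (!(x ** e) ** (y ** e)) with (!e ** (!x ** y) ** e) by grp_eq. exact H.
Qed.

(* [psi'] is [psi th] with its base point moved to the best position. The isometry x |-> b th(x)
   carries the picture of 1, x, b for [psi'] to that for [psi]; its almost fixed point x turns
   the Gromov product at one end of the segment [1,b] into the one at the other end. *)
Lemma minimal_step (th th' : G -> G) (rs : list G) : is_endomorphism G th ->
  mutually_inverse th th' ->
  exists C, 1 <= C /\ forall psi mu, minimal psi mu -> exists e mu',
  let psi' := conj_by e (fun x => psi (th x)) in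
  minimal psi' mu' /\ mu <= C * mu' /\ mu' <= C * mu /\
  (forall y, Z.abs (len (psi' y) - len (psi (th y))) <= C * mu) /\
  (forall x b r, In r rs -> x ** r = b ** th x ->
    Z.abs (len (psi' x) - d (psi b) (psi x)) <= C * mu /\
    Z.abs (gp gone (psi' x) (psi' (!(th' b))) - (2 * len (psi b) - gp gone (psi x) (psi b)))
      <= C * mu) /\
  (commutes_mod_inner th psi -> commutes_mod_inner th psi' /\
    forall x y, gp gone (psi x) (psi y) <= C * gp gone (psi' x) (psi' y) + C * mu).
Proof.
  intros Hth Hinv. pose proof (D_pos L) as HD.
  destruct (inverse_hom_inj th th' Hth Hinv) as [Hthi Hthi'].
  destruct Hinv as [Hinv1 Hinv2].
  destruct base_point_unique as [B [HB Hbase]].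
  (* The three lists control the passage from [psi] to [psi'], the passage back, and the error
     elements [r]. *)
  destruct (len_bound_list (map th F ++ map th' F ++ rs)) as [R [HR Hlen]].
  destruct (Hlip th Hth) as [K1 [HK1 Hlip1]].
  destruct (Hlip th' (proj1 Hthi')) as [K2 [HK2 Hlip2]].
  set (K := K1 + K2).
  assert (Hup : forall x y, d (th x) (th y) <= K * d x y).
  { intros x y. unfold dist. rewrite <- hom_inv, <- Hth by trivial.
    pose proof (len_nonneg L (!x ** y)). specialize (Hlip1 (!x ** y)). unfold K. nia. }
  assert (Hlow : forall x y, d x y <= K * d (th x) (th y)).
  { intros x y. unfold dist. rewrite <- hom_inv, <- Hth by trivial.
    specialize (Hlip2 (th (!x ** y))). rewrite Hinv2 in Hlip2.
    pose proof (len_nonneg L (th (!x ** y))). unfold K. nia. }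
  destruct (gprod_quasi_isometry L th K ltac:(unfold K; lia) Hup Hlow) as [C1 [HC1 Hqi]].
  set (R1 := R + 1).
  set (c1 := B * R1). set (c2 := B * (K + R1)).
  assert (Hc1 : 0 <= c1) by (unfold c1, R1; nia).
  assert (Hc2 : 0 <= c2) by (unfold c2, R1, K; nia).
  set (C := R1 + 6 * c1 + 2 * R1 + K + 6 * (K * c2) + C1).
  assert (HKc2 : 0 <= K * c2) by (unfold K; nia).
  exists C. split; [unfold C, R1, K; lia|]. intros psi mu Hmin.
  assert (Hpsi : hom_inj psi) by apply Hmin.
  assert (Hmu : 100 * D <= mu) by apply Hmin.
  assert (Hch : hom_inj (fun x => psi (th x))) by now apply comp_hom_inj.
  destruct (exists_minimal L F Hlarge _ Hch) as [p [mu' Hmin']].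
  set (e := !p) in *. set (psi' := conj_by e (fun x => psi (th x))) in *.
  exists e, mu'. cbv zeta. fold psi'.
  assert (Hmu' : 100 * D <= mu') by apply Hmin'.
  assert (HR1mu : 0 <= R * mu) by nia.
  assert (Hd : forall s q, d q (psi' s ** q) = d (!e ** q) (psi (th s) ** (!e ** q))).
  { intros s q. unfold psi', conj_by. rewrite <- (dist_mul (!e) q). f_equal. grp_eq. }
  assert (HF : forall s, In s F -> len (psi (th s)) <= R * mu).
  { intros s Hs. apply (Hlen psi mu (proj1 Hmin)). apply in_app_iff. left. now apply in_map. }
  assert (Hmu1 : mu' <= R * mu).
  { destruct (proj2 Hmin' e) as [s [Hs Hq]]. rewrite Hd, gmul_Vl, gmul_1r, dist_one in Hq.
    specialize (HF s Hs). lia. }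
  assert (Hmu2 : mu <= R * mu').
  { destruct (proj2 Hmin (!e)) as [s [Hs Hq]].
    assert (Hin : In (th' s) (map th F ++ map th' F ++ rs))
      by (rewrite !in_app_iff; right; left; now apply in_map).
    pose proof (Hlen psi' mu' (proj1 Hmin') _ Hin) as K3.
    specialize (Hd (th' s) gone). rewrite !gmul_1r, dist_one, Hinv1 in Hd. lia. }
  (* For psi th both 1 and [!e] have displacement at most a bounded multiple of [mu], so
     [base_point_unique] keeps them close. *)
  assert (He : len e <= c1 * mu).
  { rewrite <- (len_inv L), <- dist_one. unfold c1. rewrite <- Z.mul_assoc.
    apply (Hbase (fun x => psi (th x))); trivial.
    - unfold R1. nia.
    - intros s Hs. rewrite gmul_1r, dist_one. specialize (HF s Hs). unfold R1. lia.
    - intros s Hs. specialize (Hd s gone). rewrite !gmul_1r, dist_one in Hd.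
      destruct Hmin' as [[_ [_ Hs']] _]. specialize (Hs' s Hs). unfold R1. lia. }
  assert (Hc1mu : 0 <= c1 * mu) by nia. assert (Hc2mu : 0 <= c2 * mu) by nia.
  assert (HKc2mu : 0 <= K * c2 * mu) by nia. assert (HC1mu : C1 <= C1 * mu) by nia.
  assert (HKmu : 0 <= K * mu) by (unfold K; nia).
  assert (HCmu : C * mu = 3 * (R * mu) + 3 * mu + 6 * (c1 * mu) + K * mu + 6 * (K * c2 * mu) + C1 * mu)
    by (unfold C, R1; ring).
  assert (HCR : R <= C) by (unfold C, R1, K; lia).
  split; [trivial|]. split; [|split; [|split; [|split]]].
  - nia.
  - lia.
  - intros y. pose proof (len_conj_close e (psi (th y))) as A. unfold psi', conj_by. lia.
  - intros x b r Hr Hx.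
    assert (Hlr : len (psi r) <= R * mu).
    { apply (Hlen psi mu (proj1 Hmin)). rewrite !in_app_iff. auto. }
    assert (Hx' : psi x ** psi r = psi b ** psi (th x)).
    { destruct Hpsi as [Hpsi _]. now rewrite <- !Hpsi, Hx. }
    pose proof (len_conj_close e (psi (th x))) as A1.
    assert (E1 : len (psi (th x)) = d (psi b) (psi x ** psi r)).
    { rewrite Hx'. unfold dist. f_equal. grp_eq. }
    pose proof (dist_tri L (psi b) (psi x) (psi x ** psi r)) as T1.
    pose proof (dist_tri L (psi b) (psi x ** psi r) (psi x)) as T2.
    rewrite (dist_sym L (psi x ** psi r)), dist_mul_r in T2. rewrite dist_mul_r in T1.
    assert (H1 : Z.abs (len (psi' x) - d (psi b) (psi x)) <= 2 * (c1 * mu) + R * mu).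
    { unfold psi', conj_by. lia. }
    split; [lia|].
    assert (E2 : psi' (!(th' b)) = e ** !(psi b) ** !e).
    { unfold psi', conj_by. rewrite (hom_inv th), Hinv1, (hom_inv psi); trivial. apply Hpsi. }
    pose proof (len_conj_close e (!(psi b))) as A2. rewrite (len_inv L (psi b)) in A2.
    assert (E3 : d (psi' x) (psi' (!(th' b))) = d (psi x ** psi r ** !e) (gone ** !e)).
    { rewrite E2. unfold psi', conj_by. rewrite Hx'.
      unfold dist. f_equal. grp_eq. }
    pose proof (dist_move_r (psi x ** psi r) gone (!e)) as A3. rewrite (len_inv L e) in A3.
    rewrite (dist_sym L _ gone), dist_one in A3.
    pose proof (len_mul L (psi x) (psi r)) as T3.
    pose proof (len_mul L (psi x ** psi r) (!(psi r))) as T4. rewrite (len_inv L) in T4.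
    replace (psi x ** psi r ** !(psi r)) with (psi x) in T4 by grp_eq.
    unfold gprod. rewrite !dist_one, E3, E2, (dist_sym L (psi x) (psi b)). lia.
  - intros [g Hg]. set (w := e ** g).
    assert (Hw : forall y, psi' y = w ** th (psi y) ** !w).
    { intro y. unfold psi', conj_by, w. rewrite Hg. grp_eq. }
    assert (Hlw : len w <= c2 * mu).
    { rewrite <- (len_inv L), <- dist_one. unfold c2. rewrite <- Z.mul_assoc.
      apply (Hbase (fun x => th (psi x))); [now apply comp_hom_inj|unfold R1, K; nia| |].
      - intros s Hs. rewrite gmul_1r, dist_one. specialize (Hup gone (psi s)).
        rewrite (hom_one th), !dist_one in Hup by trivial.
        assert (Hls : len (psi s) <= mu) by now apply Hmin.
        assert (K * len (psi s) <= K * mu) by (apply Z.mul_le_mono_nonneg_l; unfold K; lia).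
        unfold R1. lia.
      - intros s Hs. assert (Hls : len (psi' s) <= mu') by now apply Hmin'.
        rewrite Hw in Hls. unfold dist, R1.
        replace (!(!w) ** (th (psi s) ** !w)) with (w ** th (psi s) ** !w) by grp_eq. lia. }
    split.
    + exists (e ** g ** !(th e)). intro y. unfold psi' at 2, conj_by.
      rewrite !Hth, (hom_inv th) by trivial. unfold psi', conj_by. rewrite Hg. grp_eq.
    + intros x y. specialize (Hqi gone (psi x) (psi y)). rewrite (hom_one th) in Hqi by trivial.
      pose proof (len_conj_close w (th (psi x))) as A1.
      pose proof (len_conj_close w (th (psi y))) as A2.
      pose proof (dist_move_r (th (psi x)) (th (psi y)) (!w)) as A3. rewrite (len_inv L w) in A3.
      assert (E : d (psi' x) (psi' y) = d (th (psi x) ** !w) (th (psi y) ** !w)).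
      { rewrite !Hw, !gmul_assoc_r, dist_mul. reflexivity. }
      assert (Hgp : gp gone (th (psi x)) (th (psi y)) <= gp gone (psi' x) (psi' y) + 6 * (c2 * mu)).
      { unfold gprod. rewrite E, !dist_one, !Hw. lia. }
      assert (K * gp gone (th (psi x)) (th (psi y)) <= K * (gp gone (psi' x) (psi' y) + 6 * (c2 * mu)))
        by (apply Z.mul_le_mono_nonneg_l; unfold K; lia).
      assert (K * gp gone (psi' x) (psi' y) <= C * gp gone (psi' x) (psi' y)).
      { apply Z.mul_le_mono_nonneg_r; [apply (gprod_nonneg L)|]. unfold C, R1. lia. }
      lia.
Qed.

(* If the segments [1,x] and [1,b] share a long initial part, the same holds for the next minimal
   automorphism, where [x] has become shorter. *)
Lemma descent (th th' : G -> G) (rs : list G) (M : Z) : is_endomorphism G th ->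
  mutually_inverse th th' -> 0 <= M ->
  exists T N, 0 <= T /\ 0 <= N /\ forall b,
  (forall psi mu, minimal psi mu ->
    N * mu <= len (psi b) /\ gp gone (psi b) (psi (!(th' b))) <= M * mu) ->
  forall x r, In r rs -> x ** r = b ** th x ->
  forall psi mu, minimal psi mu -> commutes_mod_inner th psi ->
  gp gone (psi x) (psi b) < T * mu.
Proof.
  intros Hth Hinv HM. pose proof (D_pos L) as HD.
  destruct (minimal_step th th' rs Hth Hinv) as [C [HC Hstep]].
  (* [T] is large enough to beat [M * mu'] after division by [C]; [N] makes an almost complete
     overlap with [1,b] exceed [T * mu'] after the same division. *)
  set (T := C * M * C + 2 * C + 1). set (N := C * T * C + M * C + 2 * C + 2).
  assert (HT : 0 <= T) by (unfold T; nia).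
  assert (HMC : 0 <= M * C) by nia.
  assert (HN : 0 <= N) by (unfold N; nia).
  exists T, N. split; [trivial|]. split; [trivial|]. intros b Hb x r Hr Hx.
  enough (K : forall n psi mu, (Z.to_nat (len (psi x)) <= n)%nat -> minimal psi mu ->
    commutes_mod_inner th psi -> gp gone (psi x) (psi b) < T * mu) by eauto.
  induction n as [n IH] using lt_wf_ind. intros psi mu Hn Hmin Hcom.
  destruct (Z.lt_ge_cases (gp gone (psi x) (psi b)) (T * mu)) as [|Hbig]; trivial. exfalso.
  destruct (Hstep psi mu Hmin) as [e [mu' Hs]]. cbv zeta in Hs.
  set (psi' := conj_by e (fun x => psi (th x))) in *.
  destruct Hs as [Hmin' [Hmu1 [Hmu2 [_ [Hx' Hcom']]]]].
  destruct (Hx' x b r Hr Hx) as [Hlen Hgp]. destruct (Hcom' Hcom) as [Hcom1 Hqi].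
  specialize (Hqi x b).
  assert (Hmu : 100 * D <= mu) by apply Hmin. assert (Hmu' : 100 * D <= mu') by apply Hmin'.
  destruct (Hb psi mu Hmin) as [HbN _]. destruct (Hb psi' mu' Hmin') as [_ HbM].
  assert (F1 : M * mu' <= M * C * mu) by nia.
  assert (F2 : C * (M * mu') <= C * M * C * mu) by nia.
  assert (F3 : C * (T * mu') <= C * T * C * mu) by nia.
  assert (F4 : N * mu = C * T * C * mu + M * C * mu + 2 * (C * mu) + 2 * mu) by (unfold N; ring).
  assert (F5 : T * mu = C * M * C * mu + 2 * (C * mu) + mu) by (unfold T; ring).
  assert (F6 : 0 <= M * C * mu) by nia.
  assert (F7 : 0 <= C * T * C * mu) by (assert (0 <= C * T * C) by nia; nia).
  assert (F8 : 0 <= C * mu) by nia.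
  assert (F9 : C * D <= C * mu) by nia.
  assert (G1 : M * mu' + D < gp gone (psi' x) (psi' b)).
  { apply Z.nle_gt. intro K.
    assert (C * gp gone (psi' x) (psi' b) <= C * (M * mu' + D)) by (apply Z.mul_le_mono_nonneg_l; lia).
    lia. }
  (* For [psi'] the segment to [x] follows [1,b], hence leaves the segment to [!(th' b)] early. By
     [minimal_step] this means that for [psi] it follows [1,b] almost to the end. *)
  pose proof (gprod_hyp L gone (psi' b) (psi' (!(th' b))) (psi' x)) as G2.
  rewrite (gprod_sym L gone (psi' b) (psi' x)) in G2.
  assert (G3 : 2 * len (psi b) - (M * C * mu + mu + C * mu) <= gp gone (psi x) (psi b)) by lia.
  assert (G4 : T * mu' <= gp gone (psi' x) (psi' b)).
  { apply Z.nlt_ge. intro K.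
    assert (C * gp gone (psi' x) (psi' b) < C * (T * mu')) by (apply Z.mul_lt_mono_pos_l; lia).
    lia. }
  (* [len (psi' x)] is about the distance from [psi b] to [psi x], which is [len (psi x)] minus
     almost all of the long [len (psi b)]. *)
  assert (Hshort : len (psi' x) < len (psi x)).
  { unfold gprod in G3. rewrite !dist_one, (dist_sym L (psi x)) in G3. lia. }
  pose proof (len_nonneg L (psi' x)).
  specialize (IH (Z.to_nat (len (psi' x))) ltac:(lia) psi' mu' ltac:(lia) Hmin' Hcom1). lia.
Qed.

(** Take b = h^m t with [h] universal and [t] such that th'(b)^-1 = k^-m s, where [k] is a conjugate
    of [th' h] independent of [h]. The overlap bound does not depend on [m], so [M] is fixed before
    [N]. *)
Lemma diverging_element (th th' : G -> G) : is_endomorphism G th -> mutually_inverse th th' ->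
  exists M, 0 <= M /\ forall N, exists b, forall psi mu, minimal psi mu ->
  N * mu <= len (psi b) /\ N * mu <= len (psi (!(th' b))) /\
  gp gone (psi b) (psi (!(th' b))) <= M * mu.
Proof.
  intros Hth Hinv. pose proof (D_pos L) as HD.
  destruct (inverse_hom_inj th th' Hth Hinv) as [Hthi Hthi'].
  destruct (minimal_step th' th nil (proj1 Hthi') (conj (proj2 Hinv) (proj1 Hinv))) as [C [HC Hstep]].
  destruct Hinv as [Hinv1 Hinv2].
  destruct (universal_element L F Hgen Hlarge HG) as [h [N0 [C0 [Hh [HN0 [HC0 Hgrow]]]]]].
  assert (Hh' : infinite_order (th' h)).
  { apply (infinite_order_hom th); trivial. now rewrite Hinv1. }
  destruct (exists_not_commensurable L h (th' h) HG Hh Hh') as [s Hs].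
  set (k := s ** th' h ** !s) in *.
  assert (Hk : infinite_order k) by now apply infinite_order_conj.
  destruct (not_commensurable_independent L h k Hh Hk Hs) as [Hind _].
  set (t := th (!s)).
  destruct (overlap_bound L) as [Mo [HMo Hov]].
  destruct (len_bound_list [h; k; t; s]) as [R [HR Hlen]].
  exists (Mo * (R + 1) + 4 * R). split; [nia|]. intro N.
  set (N1 := Z.max 0 (C * (Z.max 0 N + C))).
  set (m := Z.to_nat (C0 + N0 * (N1 + R) + 1)).
  assert (Hm : C0 + N0 * (N1 + R) + 1 <= Z.of_nat m) by (unfold m; lia).
  exists (h ^^ m ** t).
  assert (Hb : forall psi mu, minimal psi mu -> N1 * mu <= len (psi (h ^^ m ** t))).
  { intros psi mu Hmin. assert (Hmu : 100 * D <= mu) by apply Hmin.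
    assert (Hpsi : is_endomorphism G psi) by apply Hmin.
    pose proof (Hgrow psi mu Hmin m) as Hg.
    pose proof (Hlen psi mu (proj1 Hmin) t ltac:(cbn; auto)) as Ht.
    rewrite Hpsi, (hom_pow psi h m Hpsi).
    pose proof (len_mul L (psi h ^^ m ** psi t) (!(psi t))) as T1. rewrite (len_inv L) in T1.
    replace (psi h ^^ m ** psi t ** !(psi t)) with (psi h ^^ m) in T1 by grp_eq.
    assert (A1 : (C0 + N0 * (N1 + R) + 1) * mu <= Z.of_nat m * mu)
      by (apply Z.mul_le_mono_nonneg_r; lia).
    assert (A2 : N0 * ((N1 + R) * mu) < N0 * len (psi h ^^ m)) by lia.
    assert (A3 : (N1 + R) * mu < len (psi h ^^ m)) by nia. lia. }
  intros psi mu Hmin. assert (Hmu : 100 * D <= mu) by apply Hmin.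
  assert (Hpsi : hom_inj psi) by apply Hmin.
  assert (HN1 : N * mu <= N1 * mu) by (apply Z.mul_le_mono_nonneg_r; unfold N1; nia).
  split; [|split].
  - specialize (Hb psi mu Hmin). lia.
  - rewrite (hom_inv psi), (len_inv L) by apply Hpsi.
    (* The length of [psi (th' b)] is close to that of [b] under the next minimal homomorphism, to
       which [Hb] applies. *)
    destruct (Hstep psi mu Hmin) as [e [mu' Hst]]. cbv zeta in Hst.
    destruct Hst as [Hmin' [Hmu1 [_ [Hy _]]]].
    specialize (Hy (h ^^ m ** t)). specialize (Hb _ mu' Hmin').
    assert (Hmu' : 100 * D <= mu') by apply Hmin'.
    assert (A1 : (Z.max 0 N + C) * mu <= (Z.max 0 N + C) * (C * mu'))
      by (apply Z.mul_le_mono_nonneg_l; lia).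
    assert (A2 : (C * (Z.max 0 N + C)) * mu' <= N1 * mu')
      by (apply Z.mul_le_mono_nonneg_r; unfold N1; lia).
    assert (A3 : N * mu <= Z.max 0 N * mu) by (apply Z.mul_le_mono_nonneg_r; lia).
    lia.
  - destruct Hthi' as [Hth' _]. destruct Hpsi as [Hpsi Hpsi'].
    assert (E : !(th' (h ^^ m ** t)) = !(k ^^ m) ** s).
    { unfold k, t. rewrite Hth', Hinv2, (hom_pow th' h m Hth'), npow_conj. grp_eq. }
    rewrite E, !Hpsi, (hom_inv psi _ Hpsi), !(hom_pow psi _ m Hpsi).
    assert (HRmu : 0 <= R * mu) by nia.
    assert (Hl : forall g, In g [h; k; t; s] -> len (psi g) <= R * mu)
      by (intros g Hg; now apply (Hlen psi mu (proj1 Hmin))).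
    pose proof (Hl t ltac:(cbn; auto)) as Ht. pose proof (Hl s ltac:(cbn; auto)) as Hs'.
    pose proof (Hl h ltac:(cbn; auto)) as Hlh. pose proof (Hl k ltac:(cbn; auto)) as Hlk.
    assert (A : gp gone (psi h ^^ m) (!(psi k ^^ m)) <= Mo * ((R + 1) * mu)).
    { apply (Hov (psi h) (psi k)); try lia.
      - apply npow_comm_self.
      - apply comm_inv_r, npow_comm_self.
      - now apply comm_independent_hom. }
    pose proof (gprod_move L gone (!(psi k ^^ m)) (psi h ^^ m) (psi h ^^ m ** psi t)) as M1.
    pose proof (gprod_move L gone (psi h ^^ m ** psi t) (!(psi k ^^ m)) (!(psi k ^^ m) ** psi s)) as M2.
    rewrite dist_mul_r in M1, M2.
    rewrite !(gprod_sym L gone (!(psi k ^^ m))) in M1. lia.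
Qed.

(** If x r = a phi(x), the product of [x] with [a] for [psi] and with [a'] for [psi'] add up to
    nearly [2 * len (psi a)]. Applied to [phi] and to its inverse, [descent] bounds both, while [a]
    is chosen too long for that. *)
Theorem infinitely_many_twisted_classes (phi : G -> G) : is_automorphism G phi ->
  reidemeister_infinite G phi.
Proof.
  intros [Hphi [Hinj Hsurj]] [reps Hreps]. pose proof (D_pos L) as HD.
  destruct (choose_function _ Hsurj) as [phi' Hphi1].
  assert (Hinv : mutually_inverse phi phi').
  { split; trivial. intro x. apply Hinj. now rewrite Hphi1. }
  assert (Hinv' : mutually_inverse phi' phi) by (split; apply Hinv).
  destruct (inverse_hom_inj phi phi' Hphi Hinv) as [Hphi_i [Hphi' Hphi'_i]].
  set (reps' := map (fun r => !(phi' r)) reps).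
  destruct (diverging_element phi phi' Hphi Hinv) as [M [HM Hdiv]].
  destruct (descent phi phi' reps M Hphi Hinv HM) as [T1 [N1 [HT1 [HN1 Hdesc1]]]].
  destruct (descent phi' phi reps' M Hphi' Hinv' HM) as [T2 [N2 [HT2 [HN2 Hdesc2]]]].
  destruct (minimal_step phi phi' reps Hphi Hinv) as [C [HC Hstep]].
  destruct (Hdiv (N1 + N2 + T1 + T2 * C + C)) as [a Ha].
  set (a' := !(phi' a)) in *.
  assert (Ea' : !(phi a') = a) by (unfold a'; rewrite (hom_inv phi), (proj1 Hinv); trivial; grp_eq).
  destruct (Hreps a) as [r [Hr [x Hx]]].
  assert (Hxr : x ** r = a ** phi x) by (rewrite Hx; grp_eq).
  (* The twisted equation for [phi] becomes one of the same shape for the inverse, with [a'] for [a]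
     and error in [reps']. *)
  assert (Hxr' : x ** !(phi' r) = a' ** phi' x).
  { assert (E : phi' x ** phi' r = phi' a ** x)
      by now rewrite <- Hphi', Hxr, Hphi', (proj2 Hinv).
    unfold a'. apply (gmul_cancel_l (phi' a)), (gmul_cancel_r _ _ (phi' r)).
    rewrite !gmul_assoc_r, gmul_Vl, gmul_1r, gmul_Vr_assoc. now symmetry. }
  assert (Hid : @hom_inj G (fun x => x)) by (split; [now intros y z|trivial]).
  destruct (exists_minimal L F Hlarge _ Hid) as [p [mu Hmin]].
  set (psi := conj_by (!p) (fun x : G => x)) in *.
  assert (Hcom : commutes_mod_inner phi psi).
  { exists (!p ** phi p). intro y. unfold psi, conj_by.
    rewrite !Hphi, !(hom_inv phi) by trivial. grp_eq. }
  destruct (Hstep psi mu Hmin) as [e [mu' Hs]]. cbv zeta in Hs.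
  set (psi' := conj_by e (fun x => psi (phi x))) in *.
  destruct Hs as [Hmin' [Hmu1 [Hmu2 [_ [Hxs _]]]]].
  destruct (Hxs x a r Hr Hxr) as [_ Hgp]. fold a' in Hgp.
  assert (Hcom' : commutes_mod_inner phi' psi').
  { exists (e ** !p ** !(phi' (e ** !p))). intro y. unfold psi', psi, conj_by.
    rewrite (proj1 Hinv), !Hphi', (proj2 Hinv), !(hom_inv phi') by trivial. grp_eq. }
  assert (Hpos : forall psi mu, minimal psi mu -> forall n n', n <= n' -> n * mu <= n' * mu).
  { intros psi0 mu0 H0 n n' Hn. apply Z.mul_le_mono_nonneg_r; trivial.
    destruct H0 as [[_ [? _]] _]. lia. }
  assert (HT2C : 0 <= T2 * C) by nia.
  assert (B1 : gp gone (psi x) (psi a) < T1 * mu).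
  { apply (Hdesc1 a) with (r := r); trivial. intros psi0 mu0 H0.
    destruct (Ha psi0 mu0 H0) as [A1 [_ A2]]. split; [|exact A2].
    apply Z.le_trans with (2 := A1). apply (Hpos psi0); trivial. lia. }
  assert (B2 : gp gone (psi' x) (psi' a') < T2 * mu').
  { apply (Hdesc2 a') with (r := !(phi' r)); trivial.
    - intros psi0 mu0 H0. rewrite Ea'.
      destruct (Ha psi0 mu0 H0) as [_ [A1 A2]]. split; [|now rewrite (gprod_sym L)].
      apply Z.le_trans with (2 := A1). apply (Hpos psi0); trivial. lia.
    - now apply (in_map (fun r => !(phi' r))). }
  destruct (Ha psi mu Hmin) as [A1 _].
  assert (Hmu : 100 * D <= mu) by apply Hmin.
  assert (T2 * mu' <= T2 * (C * mu)) by (apply Z.mul_le_mono_nonneg_l; lia).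
  assert (0 <= N1 * mu /\ 0 <= N2 * mu /\ 0 <= T1 * mu /\ 0 <= T2 * C * mu /\ mu <= C * mu) by nia.
  lia.
Qed.

End TwistedConjugacy.

(** * Word lengths *)

Section WordLength.
Context {G : Group} (S : list G).
Implicit Types x y z g h s : G.
Implicit Types w : list (bool * G).
Local Notation eval := (eval_word G).
Local Notation over := (word_over G S).

Lemma eval_app w w' : eval (w ++ w') = eval w ** eval w'.
Proof.
  unfold eval_word. induction w as [|l w IH]; cbn; [grp_eq|]. rewrite IH. grp_eq.
Qed.

Lemma over_app w w' : over (w ++ w') <-> over w /\ over w'.
Proof.
  unfold word_over. split.
  - intro H. split; intros l Hl; apply H, in_app_iff; auto.
  - intros [H H'] l Hl. apply in_app_iff in Hl. destruct Hl; auto.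
Qed.

Lemma over_cons l w : over (l :: w) -> In (snd l) S /\ over w.
Proof. intro H. split; [apply H; now left|intros l' Hl'; apply H; now right]. Qed.

Lemma inverse_word w : over w ->
  exists w', over w' /\ length w' = length w /\ eval w' = !(eval w).
Proof.
  induction w as [|[b s] w IH]; intro H.
  - exists []. repeat split; trivial. cbn. grp_eq.
  - apply over_cons in H. destruct H as [Hs H]. destruct (IH H) as [w' [H1 [H2 H3]]].
    exists (w' ++ [(negb b, s)]). repeat split.
    + apply over_app. split; trivial. intros l [<-|[]]. exact Hs.
    + rewrite length_app, H2. cbn. lia.
    + rewrite eval_app, H3. cbn. rewrite ginv_mul. f_equal.
      destruct b; unfold letter_val; cbn; grp_eq.
Qed.

Lemma finitely_many_words n : exists l, forall w, over w -> (length w <= n)%nat -> In (eval w) l.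
Proof.
  induction n as [|n [l Hl]].
  - exists [gone]. intros [|a w] _ H; cbn in *; [auto|lia].
  - exists (gone :: map (fun p => fst p ** snd p) (list_prod (S ++ map ginv S) l)).
    intros [|[b s] w] Hw H; [now left|right].
    apply over_cons in Hw. destruct Hw as [Hs Hw]. cbn in Hs, H.
    apply in_map_iff. exists (letter_val G (b, s), eval w). split; [reflexivity|].
    apply in_prod; [|apply Hl; [trivial|lia]].
    apply in_app_iff. destruct b; [right; exact (in_map ginv S s Hs)|left; exact Hs].
Qed.

(** Stated for any symmetric subadditive [f] to cover both the length after an endomorphism and the
    displacement of a point. *)
Lemma length_eval_le (f : G -> Z) (K : Z) w : f gone = 0 ->
  (forall x y, f (x ** y) <= f x + f y) -> (forall x, f (!x) = f x) ->
  (forall s, In s S -> f s <= K) -> over w -> f (eval w) <= K * Z.of_nat (length w).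
Proof.
  intros H1 Hm Hi HS. induction w as [|[b s] w IH]; intro Hw; [cbn; lia|].
  apply over_cons in Hw. destruct Hw as [Hs Hw]. specialize (IH Hw). specialize (HS s Hs).
  change (eval ((b, s) :: w)) with (letter_val G (b, s) ** eval w).
  specialize (Hm (letter_val G (b, s)) (eval w)).
  assert (E : f (letter_val G (b, s)) = f s) by (destruct b; cbn; trivial).
  cbn [length]. lia.
Qed.

Context (HS : generates G S).

Definition is_word_length (len : G -> Z) : Prop := forall g,
  (exists w, over w /\ eval w = g /\ Z.of_nat (length w) = len g) /\
  (forall w, over w -> eval w = g -> len g <= Z.of_nat (length w)).

Lemma word_length_exists : exists len, is_word_length len.
Proof.
  apply (choose_function (fun g (n : Z) =>
    (exists w, over w /\ eval w = g /\ Z.of_nat (length w) = n) /\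
    (forall w, over w -> eval w = g -> n <= Z.of_nat (length w)))).
  intro g. destruct (nat_least (fun n => exists w, over w /\ eval w = g /\ length w = n))
    as [n [[w [H1 [H2 H3]]] Hmin]].
  - destruct (HS g) as [w [Hw Hg]]. eauto.
  - exists (Z.of_nat n). split; [exists w; subst; auto|].
    intros w' H1' H2'. apply inj_le, Hmin. eauto.
Qed.

Context (len : G -> Z) (Hlen : is_word_length len).
Local Notation d := (dist len).

Lemma word_length_eval w : over w -> len (eval w) <= Z.of_nat (length w).
Proof. intro Hw. now apply Hlen. Qed.

Lemma word_length_one : len gone = 0.
Proof.
  assert (H : over []) by now intros l [].
  apply word_length_eval in H. destruct (Hlen gone) as [[w [_ [_ E]]] _]. cbn in H. lia.
Qed.

Lemma word_length_mul x y : len (x ** y) <= len x + len y.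
Proof.
  destruct (Hlen x) as [[w [H1 [<- <-]]] _]. destruct (Hlen y) as [[w' [H1' [<- <-]]] _].
  rewrite <- eval_app, <- Nat2Z.inj_add, <- length_app. apply word_length_eval.
  now apply over_app.
Qed.

Lemma word_length_inv x : len (!x) = len x.
Proof.
  assert (H : forall y, len (!y) <= len y).
  { intro y. destruct (Hlen y) as [[w [H1 [<- <-]]] _].
    destruct (inverse_word w H1) as [w' [H1' [<- <-]]]. now apply word_length_eval. }
  apply Z.le_antisymm; [apply H|]. rewrite <- (ginv_inv x) at 1. apply H.
Qed.

Lemma word_length_dist x y : exists n, word_dist G S x y n /\ d x y = Z.of_nat n.
Proof.
  destruct (Hlen (!x ** y)) as [[w [H1 [H2 H3]]] H4].
  exists (length w). split; [split|now symmetry].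
  - exists w. repeat split; trivial. rewrite H2. grp_eq.
  - intros w' Hw' E. assert (E' : eval w' = !x ** y) by (rewrite <- E; grp_eq).
    specialize (H4 w' Hw' E'). lia.
Qed.

Lemma word_length_hyp_length delta : hyperbolic_wrt G S delta ->
  hyp_length G len (2 * Z.of_nat delta + 1).
Proof.
  intro Hhyp. split.
  - intro g. destruct (Hlen g) as [[w [_ [_ <-]]] _]. lia.
  - apply word_length_one.
  - apply word_length_inv.
  - apply word_length_mul.
  - intro r. destruct (finitely_many_words (Z.to_nat r)) as [l Hl]. exists l.
    intros g Hg. destruct (Hlen g) as [[w [H1 [<- H3]]] _]. apply Hl; trivial. lia.
  - intro g. destruct (Hlen g) as [[w [H1 [H2 H3]]] _].
    exists (fun i => eval (firstn i w)). rewrite <- H3, Nat2Z.id. repeat split.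
    + now rewrite firstn_all.
    + intros i j Hij.
      set (u := firstn i w). set (v := skipn i (firstn j w)). set (t := skipn j w).
      assert (Euv : u ++ v = firstn j w).
      { unfold u, v. rewrite <- (firstn_skipn i (firstn j w)) at 2. f_equal.
        now rewrite firstn_firstn, Nat.min_l by lia. }
      assert (Ew : w = (u ++ v) ++ t) by (rewrite Euv; symmetry; apply firstn_skipn).
      assert (Hl : length u = i /\ length v = (j - i)%nat).
      { unfold u, v. rewrite length_skipn, !length_firstn. lia. }
      pose proof H1 as Ho. rewrite Ew in Ho.
      apply over_app in Ho. destruct Ho as [Ho Hot]. apply over_app in Ho.
      destruct Ho as [Hou Hov].
      assert (Ed : d (eval u) (eval (firstn j w)) = len (eval v)).
      { rewrite <- Euv, eval_app. unfold dist. f_equal. grp_eq. }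
      rewrite Ed.
      (* No piece is longer than its number of letters and the whole word is shortest, so equality
         holds for each piece. *)
      pose proof (word_length_eval u Hou). pose proof (word_length_eval v Hov).
      pose proof (word_length_eval t Hot).
      pose proof (word_length_mul (eval u ** eval v) (eval t)) as T1.
      pose proof (word_length_mul (eval u) (eval v)) as T2.
      rewrite <- !eval_app, <- Ew, H2, <- H3 in T1. rewrite <- eval_app in T2.
      pose proof (f_equal (@length _) Ew) as El. rewrite !length_app in El. lia.
  - lia.
  - intros x y z w.
    destruct (word_length_dist x w) as [xw [Dxw ->]]. destruct (word_length_dist y w) as [yw [Dyw ->]].
    destruct (word_length_dist z w) as [zw [Dzw ->]]. destruct (word_length_dist x y) as [xy [Dxy ->]].
    destruct (word_length_dist x z) as [xz [Dxz ->]]. destruct (word_length_dist y z) as [yz [Dyz ->]].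
    specialize (Hhyp x y z w _ _ _ _ _ _ Dxw Dyw Dzw Dxy Dxz Dyz). lia.
Qed.

Lemma word_length_lipschitz th : is_endomorphism G th ->
  exists K, 1 <= K /\ forall x, len (th x) <= K * len x.
Proof.
  intro Hth.
  assert (HK : exists K, 1 <= K /\ forall s, In s S -> len (th s) <= K).
  { clear HS Hlen. induction S as [|s l [K [HK H]]].
    - exists 1. split; [lia|]. now intros s [].
    - exists (Z.max K (len (th s))). split; [lia|]. intros t [<-|Ht]; [lia|].
      specialize (H t Ht). lia. }
  destruct HK as [K [HK HKS]]. exists K. split; trivial. intro x.
  destruct (Hlen x) as [[w [H1 [<- <-]]] _].
  apply (length_eval_le (fun x => len (th x))); trivial.
  - rewrite hom_one by trivial. apply word_length_one.
  - intros y z. rewrite Hth. apply word_length_mul.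
  - intro y. rewrite hom_inv by trivial. apply word_length_inv.
Qed.

End WordLength.

Theorem theorem3 (G : Group) (phi : G -> G) :
  finitely_generated G ->
  gromov_hyperbolic_group G ->
  non_elementary G ->
  is_automorphism G phi ->
  reidemeister_infinite G phi.
Proof.
  intros _ [S [delta [HS Hhyp]]] HG Hphi.
  destruct (word_length_exists S HS) as [len Hlen].
  pose proof (word_length_hyp_length S len Hlen delta Hhyp) as L.
  (* A finite list covering [G] would make it virtually cyclic, with trivial cyclic part. *)
  assert (Hinf : forall n, exists l : list G, NoDup l /\ length l = n).
  { intro n. induction n as [|n [l [Hl <-]]]; [exists []; split; [constructor|trivial]|].
    assert (Hg : exists g, ~ In g l).
    { apply NNPP. intro N. apply HG. exists gone, l. intro g. exists g, 0. split.
      - apply NNPP. intro K. apply N. now exists g.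
      - cbn. grp_eq. }
    destruct Hg as [g Hg]. exists (g :: l). split; [now constructor|trivial]. }
  destruct (displacement_large L) as [N HN].
  destruct (Hinf (Datatypes.S N)) as [F0 [HF0 HF0l]].
  (* [S] gives displacement bounds for all elements; [F0] has enough elements to force a
     displacement of [100 * D] after any injective homomorphism. *)
  apply (infinitely_many_twisted_classes L (S ++ F0)); trivial.
  - intro g. destruct (HS g) as [w [Hw <-]]. exists (Z.of_nat (length w)). split; [lia|].
    intros psi Hpsi q A HA. rewrite Z.mul_comm.
    apply (length_eval_le S (fun x => dist len q (psi x ** q))); trivial.
    + rewrite hom_one, gmul_1l by trivial. apply (dist_refl L).
    + intros x y. rewrite Hpsi. apply (displacement_mul L).
    + intro x. rewrite hom_inv by trivial. apply (displacement_inv L).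
    + intros s Hs. apply HA, in_app_iff. now left.
  - intros psi p mu [Hpsi Hinj] Hmu. apply (HN (map psi F0) mu p).
    + apply NoDup_map_NoDup_ForallPairs; trivial. intros x y _ _. apply Hinj.
    + rewrite length_map. lia.
    + intros s Hs. apply in_map_iff in Hs. destruct Hs as [s' [<- Hs']].
      apply Hmu, in_app_iff. now right.
  - now apply word_length_lipschitz with (S := S).
Qed.
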